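(* There exists a constant $c>0$, depending only on $L,\rho,\lambda_\sigma,\kappa,\alpha,\beta,\eta$, such that if Assumption A1 holds, then for every function $F \colon \mathbb{R}^{n_L \times n} \to \mathbb{R}$ that is $1$-Lipschitz with respect to the Hilbert--Schmidt norm, and every $t > 0$, \begin{displaymath} \mathbb{P}(|F(Z_L) - \mathrm{Med}\, F(Z_L)| \ge t) \le 2\exp(-ct^2), \end{displaymath} where $\mathrm{Med}\, F(Z_L)$ denotes any median of $F(Z_L)$. Moreover, if $c_{opt} = c_{opt}(L,\rho,\lambda_\sigma,\kappa,\alpha,\beta,\eta)$ denotes the optimal (largest) constant $c$ for which the inequality $\mathbb{P}(|F(Z_L) - \mathrm{Med}\, F(Z_L)| \ge t) \le 2\exp(-ct^2)$ holds for all models satisfying Assumption A1 with these parameters, all such $F$ and all $t>0$, then, if simultaneously $\alpha\to 0$ and $\eta \to \infty$ while the other parameters are fixed, $c_{opt} \to \infty$.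
   Context: Setting: $L, n, n_0,\ldots,n_L$ are positive integers. For $\ell=0,\ldots,L-1$, $W_\ell$ is an $n_{\ell+1}\times n_\ell$ random matrix, $B_\ell$ a random vector in $\mathbb{R}^{n_{\ell+1}}$, and $\sigma_\ell\colon\mathbb{R}\to\mathbb{R}$ an activation function applied entrywise to matrices. $X$ is an $n_0\times n$ random matrix. Define $Z_0 = \frac{1}{\sqrt{n_0}}X$ and recursively $Z_{\ell+1} = \frac{1}{\sqrt{n_{\ell+1}}}\sigma_\ell(W_\ell Z_\ell + B_\ell \mathbf{1}_n^T)$, where $\mathbf{1}_n$ is the all-ones vector in $\mathbb{R}^n$. Let $\mathbf{X} = (X,(W_\ell,B_\ell)_{\ell=0,\ldots,L-1})$, viewed as a random vector in $\mathbb{R}^N$, $N = nn_0 + \sum_{\ell=0}^{L-1}(n_\ell n_{\ell+1}+n_{\ell+1})$. A random vector $\mathbf{X}$ in $\mathbb{R}^N$ satisfies the subgaussian concentration property with constant $\rho$ if for every $F\colon\mathbb{R}^N\to\mathbb{R}$ that is 1-Lipschitz w.r.t. the Euclidean norm and every $t>0$, $\mathbb{P}(|F(\mathbf{X}) - \mathrm{Med}\,F(\mathbf{X})|\ge t)\le 2\exp(-t^2/\rho^2)$. Assumption A1: (1) $\mathbf{X}$ satisfies the subgaussian concentration property with constant $\rho$; (2) $X$ and $W_\ell$, $\ell=0,\ldots,L-1$, are centered; (3) each $\sigma_\ell$ is $\lambda_\sigma$-Lipschitz with $\sup_x|\sigma_\ell(x)|\le\kappa$; (4) $n/n_\ell\le\alpha$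 for $\ell=1,\ldots,L$; (5) $n_{\ell-1}/n_\ell\le\beta$ for $\ell=1,\ldots,L$; (6) $n_0\ge\eta$. *)

(* Defs.v *)
From HB Require Import structures.
From mathcomp Require Import all_boot all_order all_algebra.
From mathcomp Require Import all_classical all_reals all_analysis.
Set Implicit Arguments. Unset Strict Implicit. Unset Printing Implicit Defensive.
Import Order.TTheory GRing.Theory Num.Theory.
Local Open Scope ring_scope.
Local Open Scope classical_set_scope.

Definition hs2 {R : realType} {p q : nat} (A : 'M[R]_(p, q)) : R :=
  \sum_(i < p) \sum_(j < q) (A i j) ^+ 2.
Definition hsnorm {R : realType} {p q : nat} (A : 'M[R]_(p, q)) : R :=
  Num.sqrt (hs2 A).

(* The parameter vector bold-X = (X, (W_l, B_l)_{l<L}) in R^N, with dims l = n_l.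
   Its Euclidean norm in R^N is the square root of the sum of the squared
   entries of all components; we write that distance out explicitly. *)
Definition param_dist {R : realType} (L n : nat) (dims : nat -> nat)
  (X X' : 'M[R]_(dims 0, n))
  (W W' : forall l : 'I_L, 'M[R]_(dims l.+1, dims l))
  (B B' : forall l : 'I_L, 'cV[R]_(dims l.+1)) : R :=
  Num.sqrt (hs2 (X - X') + \sum_(l < L) (hs2 (W l - W' l) + hs2 (B l - B' l))).

Fixpoint Zlayer {R : realType} (n : nat) (dims : nat -> nat)
  (sigma : nat -> R -> R)
  (X : 'M[R]_(dims 0, n))
  (W : forall l : nat, 'M[R]_(dims l.+1, dims l))
  (B : forall l : nat, 'cV[R]_(dims l.+1)) (l : nat) : 'M[R]_(dims l, n) :=
  match l with
  | 0 => (Num.sqrt (dims 0)%:R)^-1 *: X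
  | l'.+1 => (Num.sqrt (dims l'.+1)%:R)^-1 *:
       map_mx (sigma l') (W l' *m Zlayer sigma X W B l' + B l' *m const_mx 1)
  end.

Definition is_median {R : realType} {d} {T : measurableType d}
  (P : probability T R) (Y : T -> R) (m : R) : Prop :=
  ((2^-1)%:E <= P [set w | (Y w <= m)%R])%E /\ ((2^-1)%:E <= P [set w | (m <= Y w)%R])%E.

Definition centered {R : realType} {d} {T : measurableType d}
  (P : probability T R) (f : T -> R) : Prop :=
  P.-integrable setT (EFin \o f) /\ (\int[P]_w (f w)%:E = 0)%E.

Definition A1 {R : realType} {d} {T : measurableType d} (P : probability T R)
  (L : nat) (rho lam kappa alpha beta eta : R)
  (n : nat) (dims : nat -> nat)
  (X : T -> 'M[R]_(dims 0, n))
  (W : forall l : nat, T -> 'M[R]_(dims l.+1, dims l))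
  (B : forall l : nat, T -> 'cV[R]_(dims l.+1))
  (sigma : nat -> R -> R) : Prop :=
  [/\ (0 < n)%N, (forall l, (l <= L)%N -> (0 < dims l)%N),
      ((forall i j, measurable_fun setT (fun w => X w i j)) /\
       (forall l, (l < L)%N -> forall i j, measurable_fun setT (fun w => W l w i j)) /\
      (forall l, (l < L)%N -> forall i j, measurable_fun setT (fun w => B l w i j))) &
  [/\
      (forall (F : 'M[R]_(dims 0, n) -> (forall l : 'I_L, 'M[R]_(dims l.+1, dims l)) ->
                   (forall l : 'I_L, 'cV[R]_(dims l.+1)) -> R),
         (forall x x' w w' b b', `|F x w b - F x' w' b'| <= param_dist x x' w w' b b') ->
         let Y := fun om => F (X om) (fun l => W l om) (fun l => B l om) in
         forall m, is_median P Y m ->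
         forall t, 0 < t ->
         (P [set om | (t <= `|Y om - m|)%R] <= (2 * expR (- (t ^+ 2 / rho ^+ 2)))%:E)%E),
      ((forall i j, centered P (fun w => X w i j)) /\
       (forall l, (l < L)%N -> forall i j, centered P (fun w => W l w i j))),
      ((forall l, (l < L)%N -> forall x y, `|sigma l x - sigma l y| <= lam * `|x - y|) /\
       (forall l, (l < L)%N -> forall x, `|sigma l x| <= kappa)),
      ((forall l, (1 <= l <= L)%N -> n%:R / (dims l)%:R <= alpha) /\
       (forall l, (1 <= l <= L)%N -> (dims l.-1)%:R / (dims l)%:R <= beta)) &
      eta <= (dims 0)%:R ]].

Definition admissible_const (R : realType) (L : nat)
  (rho lam kappa alpha beta eta c : R) : Prop :=
  forall (d : measure_display) (T : measurableType d) (P : probability T R)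
    (n : nat) (dims : nat -> nat)
    (X : T -> 'M[R]_(dims 0, n))
    (W : forall l : nat, T -> 'M[R]_(dims l.+1, dims l))
    (B : forall l : nat, T -> 'cV[R]_(dims l.+1))
    (sigma : nat -> R -> R),
  A1 P L rho lam kappa alpha beta eta X W B sigma ->
  forall F : 'M[R]_(dims L, n) -> R,
  (forall A A', `|F A - F A'| <= hsnorm (A - A')) ->
  let Y := fun om => F (Zlayer sigma (X om) (fun l => W l om) (fun l => B l om) L) in
  forall m, is_median P Y m ->
  forall t, 0 < t ->
  (P [set om | (t <= `|Y om - m|)%R] <= (2 * expR (- (c * t ^+ 2)))%:E)%E.

(* Main.v *)
Require Import Defs.
From HB Require Import structures.
From mathcomp Require Import all_boot all_order all_algebra.
From mathcomp Require Import all_classical all_reals all_analysis.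
From mathcomp Require Import measurable_realfun ring lra.
Import Order.TTheory GRing.Theory Num.Theory.
Local Open Scope ring_scope.

Set Implicit Arguments.
Unset Strict Implicit.
Unset Printing Implicit Defensive.

(* Products W_l Z_l make the network only locally Lipschitz in its parameters.
   Let A be the event that the operator norms of X and W_0 are at most K sqrt n_1
   and that of W_l is at most K sqrt n_(l+1).  On A the map to Z_L is Lipschitz with
   a constant of order K / sqrt n_0 + sqrt alpha (for l >= 1 one uses
   |Z_l| <= kappa sqrt n).  Linear functionals of the parameters are centered and
   concentrated, so a union bound over grid points in the two unit balls gives
   P(~A) <= 2 exp(- n / alpha) for a suitable K.  A Lipschitz extension of F(Z_L)
   from A to all parameters is concentrated by hypothesis, and differs from F(Z_L)
   only outside A.  Since |Z_L| <= kappa sqrt n everywhere, only t <= 2 kappa sqrt n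
   matter, and for these P(~A) <= 2 exp(- t^2 / (4 kappa^2 alpha)).  Both resulting
   rates tend to infinity as alpha -> 0 and n_0 -> oo. *)

(** * Euclidean, Hilbert-Schmidt and operator norms *)

(** The norm of X is compared with sqrt n_1 because both of its sides are controlled by n_1: n <=
    alpha n_1 and n_0 <= beta n_1, whereas nothing relates n to n_0. The normalization of the first
    layer gives the factor sqrt n_1 back, whence K / sqrt n_0. The hypothesis concerns medians while
    centering concerns means; the median of a linear functional is therefore bounded by integrating
    its tail. K is built from a common bound [b] of alpha, beta and 1, which can stay fixed while
    alpha -> 0. Each of the L + 1 matrices fails its bound with probability at most 2 / (L + 1)
    exp(- n_l) for some l >= 1, and n_l >= n / alpha. *)

Definition nrm {R : realType} {I : finType} (x : I -> R) : R :=
  Num.sqrt (\sum_i x i ^+ 2).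

Section EuclideanNorm.
Context {R : realType} {I : finType}.
Implicit Types x y z : I -> R.

Lemma nrm_ge0 x : 0 <= nrm x.
Proof. exact: sqrtr_ge0. Qed.

Lemma sumsq_ge0 x : 0 <= \sum_i x i ^+ 2.
Proof. by apply: sumr_ge0 => i _; exact: sqr_ge0. Qed.

Lemma nrm_sqr x : nrm x ^+ 2 = \sum_i x i ^+ 2.
Proof. by rewrite sqr_sqrtr // sumsq_ge0. Qed.

Lemma nrm_le x (c : R) : 0 <= c -> \sum_i x i ^+ 2 <= c ^+ 2 -> nrm x <= c.
Proof.
move=> c0 h; rewrite -(ger0_norm c0) -(sqrtr_sqr c).
exact: ler_wsqrtr.
Qed.

Lemma nrm0_eq x : nrm x = 0 -> forall i, x i = 0.
Proof.
move=> h i; apply/eqP; rewrite -sqrf_eq0 eq_le sqr_ge0 andbT.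
have -> : 0 = \sum_i x i ^+ 2 by rewrite -nrm_sqr h expr0n.
rewrite (bigD1 i) //= lerDl.
by apply: sumr_ge0 => j _; exact: sqr_ge0.
Qed.

Lemma abs_le_nrm x i : `|x i| <= nrm x.
Proof.
rewrite -[`|x i|]ger0_norm // -sqrtr_sqr; apply: ler_wsqrtr.
rewrite real_normK ?num_real // (bigD1 i) //= lerDl.
by apply: sumr_ge0 => j _; exact: sqr_ge0.
Qed.

Lemma nrmZ (a : R) x : nrm (fun i => a * x i) = `|a| * nrm x.
Proof.
rewrite /nrm -sqrtr_sqr -sqrtrM ?sqr_ge0 //; congr Num.sqrt.
by rewrite mulr_sumr; apply: eq_bigr => i _; rewrite exprMn.
Qed.

Lemma eq_nrm x y : x =1 y -> nrm x = nrm y.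
Proof. by move=> e; congr Num.sqrt; apply: eq_bigr => i _; rewrite e. Qed.

Lemma cauchy_schwarz x y : \sum_i x i * y i <= nrm x * nrm y.
Proof.
have [h|h] := eqVneq (nrm x * nrm y) 0.
  move/eqP: (h); rewrite mulf_eq0 => /orP[] /eqP /nrm0_eq h0;
    by rewrite h big1 // => i _; rewrite h0 ?mul0r ?mulr0.
have p : 0 < nrm x * nrm y by rewrite lt_neqAle eq_sym h mulr_ge0 ?nrm_ge0.
have sq : 0 <= \sum_i (nrm y * x i - nrm x * y i) ^+ 2.
  by apply: sumr_ge0 => i _; exact: sqr_ge0.
have e : \sum_i (nrm y * x i - nrm x * y i) ^+ 2 =
   2 * (nrm x * nrm y) * (nrm x * nrm y - \sum_i x i * y i).
  transitivity (nrm y ^+ 2 * (\sum_i x i ^+ 2)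
      + nrm x ^+ 2 * (\sum_i y i ^+ 2)
      - 2 * (nrm x * nrm y) * \sum_i x i * y i).
    rewrite !mulr_sumr -big_split /= -sumrB; apply: eq_bigr => i _; ring.
  rewrite -!nrm_sqr; ring.
move: sq; rewrite e pmulr_rge0 ?subr_ge0 //.
by rewrite mulr_gt0 // ltr0n.
Qed.

Lemma nrmD x y : nrm (fun i => x i + y i) <= nrm x + nrm y.
Proof.
apply: nrm_le; first by rewrite addr_ge0 ?nrm_ge0.
have -> : \sum_i (x i + y i) ^+ 2 =
    nrm x ^+ 2 + nrm y ^+ 2 + 2 * \sum_i x i * y i.
  rewrite !nrm_sqr mulr_sumr -!big_split /=; apply: eq_bigr => i _; ring.
have := cauchy_schwarz x y; lra.
Qed.

Lemma nrm_distC x y : nrm (fun i => x i - y i) = nrm (fun i => y i - x i).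
Proof.
by congr Num.sqrt; apply: eq_bigr => i _; rewrite -sqrrN opprB.
Qed.

Lemma nrm_triangle y x z :
  nrm (fun i => x i - z i) <= nrm (fun i => x i - y i) + nrm (fun i => y i - z i).
Proof.
apply: le_trans (nrmD _ _); rewrite le_eqVlt; apply/orP; left; apply/eqP.
by apply: eq_nrm => i; rewrite addrA subrK.
Qed.

(** Serves to pass from the whole parameter vector to one of its matrices. *)
Lemma nrm_inj (J : finType) (h : J -> I) x :
  injective h -> nrm (fun j => x (h j)) <= nrm x.
Proof.
move=> hi; apply: ler_wsqrtr.
rewrite (eq_bigl (fun j => j \in [set: J]%SET)) => [|j]; last by rewrite inE.
rewrite -(big_imset (fun i => x i ^+ 2)) => [|i j _ _]; last exact: hi.
rewrite big_mkcond /=; apply: ler_sum => i _; case: ifP => // _.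
exact: sqr_ge0.
Qed.

End EuclideanNorm.

Definition lip {R : realType} {I : finType} (c : R) (A : set (I -> R))
    (F : (I -> R) -> R) : Prop :=
  forall x y, A x -> A y -> `|F x - F y| <= c * nrm (fun i => x i - y i).

Section HilbertSchmidt.
Context {R : realType}.

Lemma hsnormE p q (A : 'M[R]_(p, q)) :
  hsnorm A = nrm (fun ij : 'I_p * 'I_q => A ij.1 ij.2).
Proof. by rewrite /hsnorm /nrm /hs2 pair_bigA. Qed.

Lemma hsnorm_ge0 p q (A : 'M[R]_(p, q)) : 0 <= hsnorm A.
Proof. exact: sqrtr_ge0. Qed.

Lemma hs2_ge0 p q (A : 'M[R]_(p, q)) : 0 <= hs2 A.
Proof. by do 2![apply: sumr_ge0 => ? _]; exact: sqr_ge0. Qed.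

Lemma hsnorm_sqr p q (A : 'M[R]_(p, q)) : hsnorm A ^+ 2 = hs2 A.
Proof. by rewrite sqr_sqrtr // hs2_ge0. Qed.

Lemma hsnormZ p q (a : R) (A : 'M[R]_(p, q)) : hsnorm (a *: A) = `|a| * hsnorm A.
Proof.
by rewrite !hsnormE -nrmZ; apply: eq_nrm => i; rewrite mxE.
Qed.

Lemma hsnorm0 p q : hsnorm (0 : 'M[R]_(p, q)) = 0.
Proof. by rewrite -(scale0r 0) hsnormZ normr0 mul0r. Qed.

Lemma hsnormD p q (A B : 'M[R]_(p, q)) : hsnorm (A + B) <= hsnorm A + hsnorm B.
Proof.
rewrite !hsnormE; apply: le_trans (nrmD _ _).
by rewrite le_eqVlt; apply/orP; left; apply/eqP/eq_nrm => i; rewrite mxE.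
Qed.

Lemma hsnorm_distC p q (A B : 'M[R]_(p, q)) : hsnorm (A - B) = hsnorm (B - A).
Proof. by rewrite -opprB -scaleN1r hsnormZ normrN1 mul1r. Qed.

Lemma hsnorm_tr p q (A : 'M[R]_(p, q)) : hsnorm A^T = hsnorm A.
Proof.
rewrite /hsnorm /hs2 exchange_big; congr Num.sqrt.
by apply: eq_bigr => i _; apply: eq_bigr => j _; rewrite mxE.
Qed.

Lemma hsnorm_le p q (A : 'M[R]_(p, q)) c : 0 <= c -> hs2 A <= c ^+ 2 -> hsnorm A <= c.
Proof.
by move=> c0 h; rewrite hsnormE nrm_le // -(pair_bigA _ (fun i j => A i j ^+ 2)).
Qed.

Lemma ler_hsnorm p q (A B : 'M[R]_(p, q)) (c : R) : 0 <= c ->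
  (forall i j, `|A i j| <= c * `|B i j|) -> hsnorm A <= c * hsnorm B.
Proof.
move=> c0 h; apply: hsnorm_le; first by rewrite mulr_ge0 ?hsnorm_ge0.
rewrite exprMn hsnorm_sqr mulr_sumr; apply: ler_sum => i _.
rewrite mulr_sumr; apply: ler_sum => j _.
rewrite -exprMn -real_normK ?num_real // -[leRHS]real_normK ?num_real //.
by rewrite ler_sqr ?nnegrE // normrM (ger0_norm c0).
Qed.

Lemma hsnorm_const1 p n (B : 'cV[R]_p) :
  hsnorm (B *m (const_mx 1 : 'M[R]_(1, n))) = Num.sqrt n%:R * hsnorm B.
Proof.
rewrite /hsnorm -sqrtrM ?ler0n //; congr Num.sqrt.
rewrite /hs2 mulr_sumr; apply: eq_bigr => i _; rewrite big_ord1.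
rewrite (eq_bigr (fun=> B i ord0 ^+ 2)); last first.
  by move=> j _; rewrite mxE big_ord1 mxE mulr1.
by rewrite sumr_const card_ord mulr_natl.
Qed.

Lemma hsnorm_bounded p q (A : 'M[R]_(p, q)) (c : R) : 0 <= c ->
  (forall i j, `|A i j| <= c) -> hsnorm A <= c * Num.sqrt (p * q)%:R.
Proof.
move=> c0 h; apply: hsnorm_le; first by rewrite mulr_ge0 // sqrtr_ge0.
rewrite exprMn sqr_sqrtr ?ler0n //.
apply: le_trans (_ : \sum_(i < p) \sum_(j < q) c ^+ 2 <= _).
  apply: ler_sum => i _; apply: ler_sum => j _.
  by rewrite -real_normK ?num_real // ler_sqr ?nnegrE.
rewrite (eq_bigr (fun=> c ^+ 2 *+ q)); last by move=> *; rewrite sumr_const card_ord.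
by rewrite sumr_const card_ord -mulrnA mulr_natr mulnC.
Qed.

Definition bilin p q (A : 'M[R]_(p, q)) (v : 'I_p -> R) (u : 'I_q -> R) : R :=
  \sum_i \sum_j v i * A i j * u j.

Lemma bilin_mxB p q (A B : 'M[R]_(p, q)) v u :
  bilin (A - B) v u = bilin A v u - bilin B v u.
Proof.
rewrite /bilin -sumrB; apply: eq_bigr => i _; rewrite -sumrB.
by apply: eq_bigr => j _; rewrite !mxE; ring.
Qed.

Lemma bilinN p q (A : 'M[R]_(p, q)) v u : bilin (- A) v u = - bilin A v u.
Proof.
rewrite -sub0r bilin_mxB /bilin big1 ?sub0r // => i _.
by rewrite big1 // => j _; rewrite mxE; ring.
Qed.

(** Operator norm at most [s]. The bilinear form is used since, for fixed [v] and [u], it is a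
    linear functional of the entries of [A], to which concentration applies; changing the sign of
    [v] yields the absolute value. *)
Definition opbound p q (A : 'M[R]_(p, q)) (s : R) : Prop :=
  forall v u, bilin A v u <= s * (nrm v * nrm u).

Lemma bilin_tr p q (A : 'M[R]_(p, q)) v u : bilin A^T u v = bilin A v u.
Proof.
rewrite /bilin exchange_big; apply: eq_bigr => i _; apply: eq_bigr => j _.
rewrite mxE; ring.
Qed.

Lemma opbound0 p q (M : 'M[R]_(p, q)) s :
  0 <= s -> (forall i j, M i j = 0) -> opbound M s.
Proof.
move=> s0 M0 v u; rewrite /bilin big1 => [|i _]; first by rewrite !mulr_ge0 ?nrm_ge0.
by rewrite big1 // => j _; rewrite M0 mulr0 mul0r.
Qed.

Lemma opbound_tr p q (A : 'M[R]_(p, q)) s : opbound A s -> opbound A^T s.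
Proof. by move=> h v u; rewrite bilin_tr [nrm v * _]mulrC. Qed.

(** Cauchy-Schwarz between the entries of [A] and those of the rank one matrix v u^T, whose norm is
    |v| |u|. *)
Lemma opbound_hsnorm p q (A : 'M[R]_(p, q)) : opbound A (hsnorm A).
Proof.
move=> v u; rewrite hsnormE /bilin pair_bigA /=.
have := cauchy_schwarz (fun ij : 'I_p * 'I_q => A ij.1 ij.2)
  (fun ij => v ij.1 * u ij.2).
rewrite (_ : nrm (fun ij => _ * _) = nrm v * nrm u); last first.
  rewrite /nrm -sqrtrM ?sumsq_ge0 //; congr Num.sqrt.
  rewrite mulr_suml -(pair_bigA _ (fun i j => (v i * u j) ^+ 2)).
  by apply: eq_bigr => i _; rewrite mulr_sumr; apply: eq_bigr => j _; rewrite exprMn.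
apply: le_trans; rewrite le_eqVlt; apply/orP; left; apply/eqP.
by apply: eq_bigr => i _; ring.
Qed.

(** Column by column: for a column u of [Z], testing with v = A u gives |A u|^2 <= s |A u| |u|. *)
Lemma opbound_mull p q r (A : 'M[R]_(p, q)) (Z : 'M[R]_(q, r)) s : 0 <= s ->
  opbound A s -> hsnorm (A *m Z) <= s * hsnorm Z.
Proof.
move=> s0 h; apply: hsnorm_le; first by rewrite mulr_ge0 ?hsnorm_ge0.
rewrite exprMn hsnorm_sqr /hs2 exchange_big [X in _ <= _ * X]exchange_big /=.
rewrite mulr_sumr; apply: ler_sum => j _.
set v := (fun i => (A *m Z) i j); set u := (fun k => Z k j).
rewrite -[leLHS](nrm_sqr v) -(nrm_sqr u) -exprMn ler_sqr ?nnegrE ?mulr_ge0 ?nrm_ge0 //.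
have := h v u.
have -> : bilin A v u = nrm v ^+ 2.
  rewrite nrm_sqr; apply: eq_bigr => i _; rewrite expr2 {3}/v mxE mulr_sumr.
  by apply: eq_bigr => k _; rewrite mulrA.
have := nrm_ge0 v; rewrite le_eqVlt => /predU1P[<- _|v0].
  by rewrite mulr_ge0 ?nrm_ge0.
by rewrite mulrCA expr2 ler_pM2l.
Qed.

Lemma opbound_mulr p q r (M : 'M[R]_(r, p)) (A : 'M[R]_(p, q)) s : 0 <= s ->
  opbound A s -> hsnorm (M *m A) <= s * hsnorm M.
Proof.
move=> s0 /opbound_tr h.
by rewrite -hsnorm_tr trmx_mul -(hsnorm_tr M); exact: opbound_mull.
Qed.

Lemma hsnormM p q r (A : 'M[R]_(p, q)) (Z : 'M[R]_(q, r)) :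
  hsnorm (A *m Z) <= hsnorm A * hsnorm Z.
Proof. by apply: opbound_mull; [exact: hsnorm_ge0|exact: opbound_hsnorm]. Qed.

End HilbertSchmidt.

(** * A grid in the unit ball *)

(* A point of the grid (4 sqrt p)^-1 Z^p, each coordinate given by sign and
   magnitude, so that rounding towards 0 keeps the norm at most 1. *)
Definition grid (p : nat) := {ffun 'I_p -> bool * 'I_(4 * p).+1}.

Section Grid.
Context {R : realType}.

Definition gridpt p (k : grid p) (i : 'I_p) : R :=
  (-1) ^+ (k i).1 * ((k i).2 : nat)%:R / (4 * Num.sqrt p%:R).

Definition unit_grid p := [set k : grid p | nrm (gridpt k) <= 1]%SET.

Lemma grid_round p (u : 'I_p -> R) : (0 < p)%N -> nrm u <= 1 ->
  exists2 k, k \in unit_grid p & nrm (fun i => u i - gridpt k i) <= 4^-1.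
Proof.
move=> p0 u1.
have sp : 0 < Num.sqrt p%:R :> R by rewrite sqrtr_gt0 ltr0n.
have sp2 : Num.sqrt p%:R ^+ 2 = p%:R :> R by rewrite sqr_sqrtr ?ler0n.
set c : R := 4 * Num.sqrt p%:R.
have c0 : 0 < c by rewrite mulr_gt0.
(* Coordinates of [u] are at most 1 in absolute value, so their magnitudes in steps of 1 / c are at
   most 4 p and fit the range of [grid]. *)
have cp : c <= (4 * p)%:R.
  rewrite natrM ler_pM2l // -[leRHS]sp2 expr2 ler_peMl // ?(ltW sp) //.
  have := @ler_wsqrtr R 1 p%:R; rewrite sqrtr1; apply; by rewrite ler1n.
pose j i := Num.truncn (c * `|u i|).
have jle i : (j i)%:R <= c * `|u i| by rewrite truncn_le mulr_ge0 ?(ltW c0).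
have jlt i : c * `|u i| < (j i).+1%:R by exact: truncnS_gt.
have jM i : (j i < (4 * p).+1)%N.
  rewrite ltnS -(ler_nat R) (le_trans (jle i)) // (le_trans _ cp) //.
  by rewrite ler_piMr ?(ltW c0) // (le_trans (abs_le_nrm _ _)).
pose k : grid p := [ffun i => (u i < 0, Ordinal (jM i))].
have kE i : gridpt k i = (-1) ^+ (u i < 0)%R * ((j i)%:R / c).
  by rewrite /gridpt ffunE /= mulrA.
have uE i : u i = (-1) ^+ (u i < 0)%R * `|u i| by rewrite -numEsign.
have ka i : `|gridpt k i| <= `|u i|.
  rewrite kE normrM normr_sign mul1r ger0_norm ?divr_ge0 ?(ltW c0) //.
  by rewrite ler_pdivrMr // mulrC.
have ku i : `|u i - gridpt k i| <= c^-1.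
  rewrite kE {1}uE -mulrBr normrM normr_sign mul1r ger0_norm.
    rewrite lerBlDr (_ : c^-1 + _ = (1 + (j i)%:R) / c); last by rewrite mulrDl mul1r.
    rewrite ler_pdivlMr // mulrC.
    by rewrite (le_trans (ltW (jlt i))) // -natr1 addrC.
  by rewrite subr_ge0 ler_pdivrMr // mulrC.
exists k.
  rewrite inE (le_trans _ u1) // /nrm ler_wsqrtr //; apply: ler_sum => i _.
  by rewrite -real_normK ?num_real // -[leRHS]real_normK ?num_real // ler_sqr ?nnegrE.
(* Each of the p coordinates is off by at most 1 / c, which gives sqrt p / c = 1 / 4. *)
apply: nrm_le => //.
apply: le_trans (_ : \sum_(i < p) (c^-1) ^+ 2 <= _).
  apply: ler_sum => i _; rewrite -real_normK ?num_real // ler_sqr ?nnegrE //.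
  by rewrite invr_ge0 ltW.
rewrite sumr_const card_ord -[leLHS]mulr_natr -sp2 /c exprVn exprMn invfM.
by rewrite -mulrA mulVf ?expf_neq0 ?gt_eqF // mulr1 exprVn.
Qed.

Lemma sum_half m : \sum_(j < m) (2^-1 : R) ^+ j = 2 - 2 * 2^-1 ^+ m.
Proof.
elim: m => [|m ih]; first by rewrite big_ord0 expr0; ring.
by rewrite big_ord_recr /= ih exprS; field.
Qed.

(** Counting by weights. Give a grid point with magnitudes k_i the weight 2^(- sum k_i). In the unit
    ball sum k_i <= sum k_i^2 <= 16 p, so each point there weighs at least 2^(- 16 p). The total
    weight of the grid factors over coordinates, each factor being at most 2 (1 + 1/2 + 1/4 + ...) =
    4. *)
Lemma card_unit_grid p : (0 < p)%N -> (#|unit_grid p|)%:R <= 2 ^+ (18 * p) :> R.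
Proof.
move=> p0.
have sp2 : Num.sqrt p%:R ^+ 2 = p%:R :> R by rewrite sqr_sqrtr ?ler0n.
pose w (k : grid p) : R := \prod_i 2^-1 ^+ ((k i).2 : nat).
have w0 k : 0 <= w k by apply: prodr_ge0 => i _; rewrite exprn_ge0.
have wl k : k \in unit_grid p -> 1 <= 2 ^+ (16 * p) * w k.
  rewrite inE /w => k1.
  have s16 : (\sum_i ((k i).2 : nat) <= 16 * p)%N.
    rewrite -(ler_nat R) natr_sum.
    apply: (@le_trans _ _ (\sum_i (((k i).2 : nat)%:R : R) ^+ 2)).
      apply: ler_sum => i _; rewrite -natrX ler_nat.
      by case: ((k i).2 : nat) => // a; rewrite expnS leq_pmulr // expn_gt0.
    have e i : (((k i).2 : nat)%:R : R) ^+ 2 = (16 * p)%:R * gridpt k i ^+ 2.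
      have p16 : (16 * p)%:R = 4 ^+ 2 * p%:R :> R.
        by rewrite natrM; congr (_ * _); rewrite -natrX.
      rewrite p16 /gridpt !exprMn sqrr_sign mul1r exprVn exprMn sp2 mulrCA mulfV ?mulr1 //.
      by rewrite mulf_neq0 ?expf_neq0 // pnatr_eq0 -lt0n.
    rewrite (eq_bigr _ (fun i _ => e i)) -mulr_sumr -nrm_sqr.
    rewrite ler_piMr ?ler0n // expr_le1 ?nrm_ge0 //.
  rewrite (_ : \prod_i _ = 2^-1 ^+ (\sum_i ((k i).2 : nat))); last first.
    by elim/big_rec2: _ => [|i a b _ ->]; rewrite ?expr0 ?exprD.
  by rewrite exprVn ler_pdivlMr ?exprn_gt0 // mul1r ler_weXn2l // ler1n.
apply: (@le_trans _ _ (\sum_(k in unit_grid p) 2 ^+ (16 * p) * w k)).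
  rewrite -sum1_card natr_sum; apply: ler_sum => k; exact: wl.
apply: (@le_trans _ _ (\sum_k 2 ^+ (16 * p) * w k)).
  rewrite big_mkcond /=; apply: ler_sum => k _; case: ifP => // _.
  by rewrite mulr_ge0 // exprn_ge0.
rewrite -mulr_sumr /w.
rewrite -(bigA_distr_bigA (fun (_ : 'I_p) (x : bool * 'I_(4 * p).+1) => 2^-1 ^+ (x.2 : nat))).
rewrite prodr_const card_ord (_ : 18 * p = 16 * p + 2 * p)%N; last by rewrite -mulnDl.
rewrite exprD ler_pM2l ?exprn_gt0 // exprM lerXn2r ?nnegrE //.
  by rewrite sumr_ge0 // => x _; rewrite exprn_ge0.
rewrite -(pair_bigA _ (fun (b : bool) (j : 'I_(4 * p).+1) => 2^-1 ^+ (j : nat))) /=.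
rewrite big_bool /= !sum_half.
have : 0 <= 2^-1 ^+ (4 * p).+1 :> R by rewrite exprn_ge0.
lra.
Qed.

Lemma bilinZl p q (A : 'M[R]_(p, q)) a v u :
  bilin A (fun i => a * v i) u = a * bilin A v u.
Proof.
rewrite /bilin mulr_sumr; apply: eq_bigr => i _; rewrite mulr_sumr.
by apply: eq_bigr => j _; rewrite !mulrA.
Qed.

Lemma bilinZr p q (A : 'M[R]_(p, q)) a v u :
  bilin A v (fun i => a * u i) = a * bilin A v u.
Proof. by rewrite -!(bilin_tr A) bilinZl. Qed.

Lemma bilinBl p q (A : 'M[R]_(p, q)) v v' u :
  bilin A (fun i => v i - v' i) u = bilin A v u - bilin A v' u.
Proof.
rewrite /bilin -sumrB; apply: eq_bigr => i _; rewrite -sumrB.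
by apply: eq_bigr => j _; ring.
Qed.

Lemma bilinBr p q (A : 'M[R]_(p, q)) v u u' :
  bilin A v (fun i => u i - u' i) = bilin A v u - bilin A v u'.
Proof. by rewrite -!(bilin_tr A) bilinBl. Qed.

Lemma opbound_unit p q (A : 'M[R]_(p, q)) s :
  (forall v u, nrm v <= 1 -> nrm u <= 1 -> bilin A v u <= s) -> opbound A s.
Proof.
move=> h v u.
have [v0|v0] := eqVneq (nrm v) 0.
  rewrite v0 mul0r mulr0 /bilin big1 // => i _.
  by rewrite big1 // => j _; rewrite (nrm0_eq v0) !mul0r.
have [u0|u0] := eqVneq (nrm u) 0.
  rewrite u0 !mulr0 /bilin big1 // => i _.
  by rewrite big1 // => j _; rewrite (nrm0_eq u0) mulr0.
have N k (x : 'I_k -> R) : nrm x != 0 -> nrm (fun i => (nrm x)^-1 * x i) <= 1.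
  by move=> x0; rewrite nrmZ ger0_norm ?invr_ge0 ?nrm_ge0 // mulVf.
have := h _ _ (N _ _ v0) (N _ _ u0).
rewrite bilinZl bilinZr mulrA -invfM mulrC ler_pdivrMr //.
by rewrite lt_neqAle eq_sym mulf_neq0 // mulr_ge0 ?nrm_ge0.
Qed.

(* Rounding both arguments of a near-maximizer to the grid costs at most half
   of the supremum. *)
Lemma opbound_grid p q (A : 'M[R]_(p, q)) s : (0 < p)%N -> (0 < q)%N ->
  (forall k l, k \in unit_grid p -> l \in unit_grid q ->
     bilin A (gridpt k) (gridpt l) <= s / 2) -> opbound A s.
Proof.
move=> p0 q0 h.
pose E : set R := [set x | exists v u, [/\ nrm v <= 1, nrm u <= 1 & x = bilin A v u]]%classic.
have nrmz k : nrm (fun _ : 'I_k => 0 : R) <= 1.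
  by rewrite /nrm big1 ?sqrtr0 // => i _; rewrite expr0n.
have hs : has_sup E.
  split.
    by exists (bilin A (fun=> 0) (fun=> 0)); exists (fun=> 0), (fun=> 0); split; rewrite ?nrmz.
  exists (hsnorm A) => _ [v [u [v1 u1 ->]]].
  apply: (le_trans (opbound_hsnorm A v u)).
  by rewrite ler_piMr ?hsnorm_ge0 // mulr_ile1 ?nrm_ge0.
have ubE v u : nrm v <= 1 -> nrm u <= 1 -> bilin A v u <= sup E.
  by move=> v1 u1; apply: sup_upper_bound => //; exists v, u; split.
(* A rounding error scaled by 4 is again a competitor in the supremum, so rounding one argument
   costs at most [sup E / 4]. *)
have q4 k (x : 'I_k -> R) : nrm x <= 4^-1 -> nrm (fun i => 4 * x i) <= 1.
  by move=> x4; rewrite nrmZ ger0_norm //; lra.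
have supE : sup E <= s.
  suff : sup E <= s / 2 + sup E / 2 by lra.
  apply: ge_sup; first by case: hs.
  move=> _ [v [u [v1 u1 ->]]].
  have [k kg kv] := grid_round p0 v1; have [l lg lu] := grid_round q0 u1.
  have a := h _ _ kg lg.
  move: (kg); rewrite inE => k1.
  have b := ubE _ _ (q4 _ _ kv) u1; have c := ubE _ _ k1 (q4 _ _ lu).
  rewrite bilinZl bilinBl in b; rewrite bilinZr bilinBr in c; lra.
by apply: opbound_unit => v u v1 u1; rewrite (le_trans (ubE _ _ v1 u1)).
Qed.

End Grid.

Local Open Scope classical_set_scope.
Local Open Scope ring_scope.

(** * Measurability and medians *)

Section Measurability.
Context {R : realType} {d : measure_display} {T : measurableType d}.

Lemma measurable_set_lt (f : T -> R) a :
  measurable_fun setT f -> measurable [set w | f w < a].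
Proof.
move=> mf; have -> : [set w | f w < a] = setT `&` f @^-1` `]-oo, a[.
  by apply/seteqP; split => w /=; rewrite in_itv /=; [|case].
exact: mf.
Qed.

Lemma measurable_set_le (f : T -> R) a :
  measurable_fun setT f -> measurable [set w | f w <= a].
Proof.
move=> mf; have -> : [set w | f w <= a] = setT `&` f @^-1` `]-oo, a].
  by apply/seteqP; split => w /=; rewrite in_itv /=; [|case].
exact: mf.
Qed.

Lemma measurable_set_ge (f : T -> R) a :
  measurable_fun setT f -> measurable [set w | a <= f w].
Proof.
move=> mf; have -> : [set w | a <= f w] = setT `&` f @^-1` `[a, +oo[.
  by apply/seteqP; split => w /=; rewrite in_itv /= andbT; [|case].
exact: mf.
Qed.

Lemma measurable_fun_lt_set (f : T -> R) :
  (forall a, measurable [set w | f w < a]) -> measurable_fun setT f.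
Proof.
move=> h; apply: (measurability _ (RGenInftyO.measurableE R)).
move=> _ [_ [a ->] <-]; have := h a.
congr measurable; apply/seteqP; split => w /=; rewrite in_itv /=; first by [].
by case.
Qed.

Lemma measurable_nrm (I : finType) (Y : T -> I -> R) (y : I -> R) :
  (forall i, measurable_fun setT (fun w => Y w i)) ->
  measurable_fun setT (fun w => nrm (fun i => Y w i - y i)).
Proof.
move=> mY.
have mg : measurable_fun setT (fun w => \sum_i (Y w i - y i) ^+ 2).
  apply: measurable_sum => i; apply: measurable_funX.
  exact: measurable_funB (mY i) (measurable_cst _).
exact: measurableT_comp (continuous_measurable_fun (@sqrt_continuous R)) mg.
Qed.

Lemma rational_approx (I : finType) (x : I -> R) e : 0 < e ->
  exists q : {ffun I -> rat}, nrm (fun i => x i - ratr (q i)) <= e.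
Proof.
move=> e0; pose h : R := e / #|I|.+1%:R.
have h0 : 0 < h by rewrite divr_gt0 // ltr0n.
have /choice[q hq] : forall i, exists q : rat, `|x i - ratr q| <= h.
  move=> i; have : x i - h < x i + h by lra.
  move/rat_in_itvoo => [q]; rewrite in_itv /= => /andP[q1 q2].
  by exists q; rewrite ler_norml; apply/andP; split; lra.
exists (finfun q); apply: nrm_le; first exact: ltW.
apply: (@le_trans _ _ (\sum_(i : I) h ^+ 2)).
  apply: ler_sum => i _; rewrite ffunE.
  by rewrite -real_normK ?num_real // ler_sqr ?nnegrE // ltW.
rewrite sumr_const -[leLHS]mulr_natr /h exprMn exprVn -mulrA ler_piMr ?sqr_ge0 //.
rewrite mulrC ler_pdivrMr ?exprn_gt0 ?ltr0n // mul1r -natrX ler_nat.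
by rewrite (leq_trans (leqnSn _)) // expnS leq_pmulr // expn_gt0.
Qed.

(* F is the infimum of the countably many measurable functions
   F q + c |. - q|, q rational. *)
Lemma lip_measurable (I : finType) (Y : T -> I -> R) (F : (I -> R) -> R) c :
  (forall i, measurable_fun setT (fun w => Y w i)) -> lip c setT F ->
  measurable_fun setT (fun w => F (Y w)).
Proof.
(* A strictly larger constant is positive, so that the approximation error [e] can be chosen by
   dividing by it. *)
move=> mY lF; have {}lF x y : `|F x - F y| <= (`|c| + 1) * nrm (fun i => x i - y i).
  apply: (le_trans (lF x y Logic.I Logic.I)).
  by rewrite ler_wpM2r ?nrm_ge0 // (le_trans (ler_norm _)) // lerDl.
have : 0 < `|c| + 1 by rewrite ltr_wpDl.
move: (`|c| + 1) lF => {}c lF c0.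
apply: measurable_fun_lt_set => a.
pose rq (q : {ffun I -> rat}) : I -> R := fun i => ratr (q i).
rewrite (_ : [set w | _] =
  \bigcup_(q : {ffun I -> rat})
    [set w | F (rq q) + c * nrm (fun i => Y w i - rq q i) < a]).
  apply: countable_bigcupT_measurable => [|q]; first exact: countableP.
  apply: measurable_set_lt; apply: measurable_funD; first exact: measurable_cst.
  by apply: measurable_funM; [exact: measurable_cst|exact: measurable_nrm].
apply/seteqP; split => w /=.
  move=> Fa; pose e := (a - F (Y w)) / (3 * c).
  have e0 : 0 < e by rewrite divr_gt0 ?subr_gt0 // mulr_gt0.
  have [q hq] := rational_approx (Y w) e0.
  exists q => //=; have := lF (rq q) (Y w).
  rewrite nrm_distC => /(le_trans (ler_norm _)).
  have : c * nrm (fun i => Y w i - rq q i) <= c * e by rewrite ler_pM2l.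
  have -> : c * e = (a - F (Y w)) / 3 by rewrite /e; field; rewrite gt_eqF.
  by lra.
move=> [q _] /=; have := lF (Y w) (rq q) => /(le_trans (ler_norm _)).
by lra.
Qed.

End Measurability.

Section Median.
Context {R : realType} {d : measure_display} {T : measurableType d}.
Context (P : probability T R).

(** The infimum of the r with P(Y <= r) >= 1/2 is a median: right continuity of the distribution
    function gives one inequality, continuity of P along the increasing events Y <= inf S - 1/(n+1)
    the other. *)
Lemma is_median_exists (Y : T -> R) : measurable_fun setT Y ->
  exists m, is_median P Y m.
Proof.
move=> mY; pose X : {RV P >-> R} := mfun_Sub (mem_set mY).
have cdfE r : cdf X r = P [set w | Y w <= r].
  by rewrite /cdf /distribution /pushforward; congr (P _);
    apply/seteqP; split => w /=; rewrite in_itv.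
pose S : set R := [set r | (2^-1)%:E <= cdf X r]%E.
have [b bS] : S !=set0.
  have : nbhs (1 : \bar R)%E [set u : \bar R | (2^-1)%:E < u]%E.
    by apply: open_nbhs_nbhs; split; [exact: open_ereal_gt_ereal|rewrite /= lte_fin; lra].
  move/(cvg_cdfy1 X) => [M [_ hM]]; exists (M + 1).
  by apply: ltW; apply: (hM (M + 1)); rewrite ltrDl.
have [M lM] : has_lbound S.
  have : nbhs (0 : \bar R)%E [set u : \bar R | u < (2^-1)%:E]%E.
    by apply: open_nbhs_nbhs; split; [exact: open_ereal_lt_ereal|rewrite /= lte_fin; lra].
  move/(cvg_cdfNy0 X) => [M [_ hM]]; exists M => r rS; rewrite leNgt; apply/negP => /hM /=.
  by rewrite ltNge; apply/negP/negPn.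
have hi : has_inf S by split; [exists b|exists M].
exists (inf S); split.
  rewrite -cdfE leNgt; apply/negP => hlt.
  have : nbhs (cdf X (inf S)) [set u : \bar R | u < (2^-1)%:E]%E.
    by apply: open_nbhs_nbhs; split; [exact: open_ereal_lt_ereal|].
  move/(@cdf_right_continuous _ _ _ _ X) => [e /= e0 he].
  have [r rS re] := inf_adherent e0 hi.
  have : inf S <= r by apply: ge_inf => //; exists M.
  rewrite le_eqVlt => /predU1P[E|lt]; first by move: hlt; rewrite E ltNge rS.
  have /= : ball_ Num.norm (inf S) e r by rewrite /ball_ /= distrC ltr_norml; apply/andP; split; lra.
  by move/he => /(_ lt) /=; rewrite ltNge rS.
have mlt : measurable [set w | Y w < inf S] by exact: measurable_set_lt.
rewrite (_ : [set w | inf S <= Y w] = ~` [set w | Y w < inf S]); last first.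
  by apply/seteqP; split => w /=; rewrite leNgt => /negP.
rewrite probability_setC //.
suff : (P [set w | Y w < inf S]%R <= (2^-1)%:E)%E.
  rewrite -(fineK (fin_num_measure P _ mlt)) -EFinB !lee_fin; lra.
rewrite leNgt; apply/negP => hgt.
pose F (n : nat) := [set w | Y w <= inf S - n.+1%:R^-1].
have FE : [set w | Y w < inf S] = \bigcup_n F n.
  apply/seteqP; split => w /=; last first.
    by move=> [n _] /= /le_lt_trans; apply; rewrite ltrBlDr ltrDl invr_gt0 ltr0n.
  move=> h; exists (Num.truncn (inf S - Y w)^-1) => //=.
  have p0 : 0 < inf S - Y w by rewrite subr_gt0.
  have : (Num.truncn (inf S - Y w)^-1).+1%:R^-1 <= inf S - Y w.
    by rewrite -[leRHS]invrK lef_pV2 ?posrE ?invr_gt0 ?ltr0n // ltW // truncnS_gt.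
  by rewrite /F /= lerBrDr -lerBrDl.
have mF n : measurable (F n) by exact: measurable_set_le.
have cv : P \o F @ \oo --> P (\bigcup_n F n).
  apply: nondecreasing_cvg_mu => //; first exact: bigcupT_measurable.
  move=> i j ij; apply/subsetPset => w /= /le_trans; apply.
  by rewrite lerD2l lerN2 lef_pV2 ?posrE ?ltr0n // ler_nat.
have : nbhs (P (\bigcup_n F n)) [set u : \bar R | (2^-1)%:E < u]%E.
  by apply: open_nbhs_nbhs; split; [exact: open_ereal_gt_ereal|rewrite /= -FE].
move/cv => [N _ /(_ N (leqnn N))] /=; rewrite /F -cdfE => hN.
have /(ge_inf (proj2 hi)) : S (inf S - N.+1%:R^-1) by exact: ltW.
by rewrite leNgt ltrBlDr ltrDl invr_gt0 ltr0n.
Qed.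

End Median.

(** * Concentration *)

(** The concentration hypothesis for a vector with a finite index type, scaled to every Lipschitz
    constant [c] so that functions need no normalization later. *)
Definition concentrated {R : realType} {d} {T : measurableType d} {I : finType}
    (P : probability T R) (Y : T -> I -> R) (rho : R) : Prop :=
  forall F c, 0 < c -> lip c setT F ->
  forall m, is_median P (fun w => F (Y w)) m -> forall t, 0 < t ->
  (P [set w | t <= `|F (Y w) - m|]%R <=
     (2 * expR (- (t ^+ 2 / (c * rho) ^+ 2)))%:E)%E.

Section Concentration.
Context {R : realType} {d : measure_display} {T : measurableType d}.
Context (P : probability T R).

Lemma probability_union_le (J : Type) (s : seq J) (B : J -> set T) (e : R) :
  (forall j, measurable (B j)) -> (forall j, P (B j) <= e%:E)%E ->
  (P (\big[setU/set0]_(j <- s) B j) <= ((size s)%:R * e)%:E)%E.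
Proof.
move=> mB hB; elim: s => [|j s ih]; first by rewrite big_nil measure0 /= mul0r.
rewrite big_cons; apply: (le_trans (measureU2 _ _ _)) => //.
  exact: bigsetU_measurable.
by rewrite /= -natr1 addrC mulrDl mul1r EFinD leeD.
Qed.

Lemma subset_probability_le (A B : set T) e :
  measurable A -> measurable B -> A `<=` B -> (P B <= e)%E -> (P A <= e)%E.
Proof. by move=> mA mB AB; apply: le_trans; rewrite le_measure ?inE. Qed.

(** An event of probability at least 1/2 is not empty; with the next lemma, a median lies between
    two values of [Y]. *)
Lemma median_lb_nonempty Y m : is_median P Y m -> exists w, Y w <= m.
Proof.
move=> [h _]; apply: contrapT => hn; move: h.
rewrite (_ : [set w | _] = set0) ?measure0 ?lee_fin ?invr_le0 ?ler10 //; first by lra.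
by apply/seteqP; split => // w /= hw; apply: hn; exists w.
Qed.

Lemma median_ub_nonempty Y m : is_median P Y m -> exists w, m <= Y w.
Proof.
move=> [_ h]; apply: contrapT => hn; move: h.
rewrite (_ : [set w | _] = set0) ?measure0 ?lee_fin; first by lra.
by apply/seteqP; split => // w /= hw; apply: hn; exists w.
Qed.

Lemma measurable_dist (f : T -> R) m : measurable_fun setT f ->
  measurable_fun setT (fun w => `|f w - m|).
Proof.
move=> mf; have mg : measurable_fun setT (fun w => f w - m).
  exact: measurable_funB mf (measurable_cst _).
exact: (measurableT_comp (@normr_measurable R setT) mg).
Qed.

(** As f has mean 0, |m| <= E|f - m|, the integral of P(|f - m| > x) over x >= 0. Since y - y^2 <=
    1, the tail 2 exp(- y^2) with y = x / rho is at most 2 e exp(- y), which is 2 e rho times an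
    exponential density. *)
Lemma centered_median_le (f : T -> R) m rho : 0 < rho -> measurable_fun setT f ->
  centered P f ->
  (forall t, 0 < t -> (P [set w | t <= `|f w - m|]%R <=
     (2 * expR (- (t ^+ 2 / rho ^+ 2)))%:E)%E) ->
  `|m| <= 2 * expR 1 * rho.
Proof.
move=> rho0 mf [fi f0] tail.
have mg := measurable_dist m mf.
pose X : {RV P >-> R} := mfun_Sub (mem_set mg).
have mint : P.-integrable setT (EFin \o cst m).
  exact: finite_measure_integrable_cst.
have E1 : (\int[P]_w ((f w)%:E - (cst m w)%:E) = (- m)%:E)%E.
  rewrite integralB_EFin // f0 (_ : (fun x => _) = cst m%:E) // integral_cst //.
  transitivity (0 - m%:E * 1)%E; last by rewrite mule1 sub0e.
  by congr (_ - _ * _)%E; exact: probability_setT.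
have E2 : (`|m|%:E <= \int[P]_w (`|f w - m|)%:E)%E.
  rewrite -normrN -abse_EFin -E1.
  apply: (le_trans (le_abse_integral P measurableT _)) => //.
  apply/measurable_EFinP; exact: measurable_funB mf (measurable_cst _).
have E3 := @ge0_expectation_ccdf _ _ _ P X (fun=> normr_ge0 _).
rewrite expectation_def /= in E3.
have r0 : 0 < rho^-1 by rewrite invr_gt0.
pose k := 2 * expR 1 * rho.
have k0 : 0 <= k by rewrite !mulr_ge0 ?expR_ge0 ?(ltW rho0).
rewrite -lee_fin; apply: (le_trans E2); rewrite E3.
have mpdf := @measurable_exponential_pdf R rho^-1.
have mkpdf : measurable_fun setT (fun x => k%:E * (exponential_pdf rho^-1 x)%:E)%E.
  by apply: measurable_funeM; apply/measurable_EFinP.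
have pdf0 x : 0 <= exponential_pdf rho^-1 x by apply: exponential_pdf_ge0; exact: ltW.
apply: (@le_trans _ _ (\int[lebesgue_measure]_(x in `[0%R, +oo[)
    (k%:E * (exponential_pdf rho^-1 x)%:E))%E).
  apply: ge0_le_integral => //=.
  - apply: measurable_funTS; exact: ccdf_measurable.
  - exact: measurable_funTS.
  move=> x /=; rewrite in_itv /= andbT => x0.
  (* The tail hypothesis needs x > 0; at 0 a probability is at most 1 <= 2 e. *)
  have [->|xn0] := eqVneq x 0.
    apply: (@le_trans _ _ 1%E); first exact: probability_le1.
    rewrite exponential_pdfE // mulr0 expR0 mulr1 -EFinM /k mulfK ?gt_eqF // lee_fin.
    have := @expR_ge1Dx R 1; lra.
  have xp : 0 < x by rewrite lt_neqAle eq_sym xn0.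
  apply: (@le_trans _ _ (P [set w | x <= `|f w - m|]%R)).
    rewrite /ccdf /distribution /pushforward; apply: le_measure; rewrite ?inE.
    - by rewrite -[X in measurable X]setTI; apply: measurable_funPT => //.
    - exact: measurable_set_ge.
    by move=> w /=; rewrite in_itv /= andbT; exact: ltW.
  apply: (le_trans (tail _ xp)).
  rewrite exponential_pdfE // -EFinM lee_fin /k.
  rewrite (_ : _ * _ * rho * _ = 2 * (expR 1 * expR (- rho^-1 * x))); last first.
    by field; rewrite gt_eqF.
  rewrite -expRD ler_pM2l // ler_expR.
  have -> : x ^+ 2 / rho ^+ 2 = (rho^-1 * x) ^+ 2 by rewrite exprMn exprVn mulrC.
  rewrite mulNr; set y := _ * x; have := sqr_ge0 (y - 2^-1); nra.
apply: (@le_trans _ _ (\int[lebesgue_measure]_x (k%:E * (exponential_pdf rho^-1 x)%:E))%E).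
  apply: ge0_subset_integral => //=.
  by move=> x _; rewrite -EFinM lee_fin mulr_ge0.
rewrite ge0_integralZl //=.
- by rewrite integral_exponential_pdf // mule1.
- exact/measurable_EFinP.
- by move=> x _; rewrite lee_fin.
Qed.

(** Above the threshold 4 e rho the median is at most s / 2, so F >= s forces a deviation of at
    least s / 2 from it. *)
Lemma centered_upper_tail (I : finType) (Y : T -> I -> R) rho F s :
  (forall i, measurable_fun setT (fun w => Y w i)) -> 0 < rho ->
  concentrated P Y rho -> lip 1 setT F -> centered P (fun w => F (Y w)) ->
  4 * expR 1 * rho <= s ->
  (P [set w | s <= F (Y w)]%R <= (2 * expR (- (s ^+ 2 / (4 * rho ^+ 2))))%:E)%E.
Proof.
move=> mY rho0 hc lF cF hs.
have mF := lip_measurable mY lF.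
have [m hm] := is_median_exists P mF.
have tail t : 0 < t -> (P [set w | t <= `|F (Y w) - m|]%R <=
     (2 * expR (- (t ^+ 2 / rho ^+ 2)))%:E)%E.
  by move=> t0; have := hc F 1 ltr01 lF m hm t t0; rewrite mul1r.
have hmr := centered_median_le rho0 mF cF tail.
have s0 : 0 < s.
  by apply: lt_le_trans hs; rewrite !mulr_gt0 ?expR_gt0.
have s2 : 0 < s / 2 by rewrite divr_gt0.
apply: (@subset_probability_le _ [set w | s / 2 <= `|F (Y w) - m|]).
- exact: measurable_set_ge.
- by apply: measurable_set_ge; exact: measurable_dist.
- move=> w /= h; apply: le_trans (ler_norm _).
  have := ler_norm m; lra.
have := tail _ s2; congr (_ <= (2 * expR (- _))%:E)%E.
by rewrite exprMn exprVn; field; rewrite gt_eqF.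
Qed.

End Concentration.

(** * Lipschitz extension and transfer of concentration *)

Section Extension.
Context {R : realType} {I : finType}.

(** McShane's formula: H(x) is the infimum over a in A of G(a) + c |x - a|. Comparison with a fixed
    point [a0] of A shows that it is finite. *)
Lemma lipschitz_extension (A : set (I -> R)) (G : (I -> R) -> R) c :
  0 <= c -> A !=set0 -> lip c A G ->
  exists2 H, lip c setT H & forall x, A x -> H x = G x.
Proof.
move=> c0 [a0 Aa0] lG.
pose S x : set R := [set G a + c * nrm (fun i => x i - a i) | a in A].
have S0 x : S x !=set0 by exists (G a0 + c * nrm (fun i => x i - a0 i)), a0.
have Sb x : lbound (S x) (G a0 - c * nrm (fun i => x i - a0 i)).
  move=> _ [a Aa <-]; have := lG _ _ Aa0 Aa => /(le_trans (ler_norm _)).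
  have := ler_wpM2l c0 (nrm_triangle x a0 a).
  rewrite (nrm_distC a0 x) mulrDr; lra.
have hS x : has_inf (S x) by split; [|exists (G a0 - c * nrm (fun i => x i - a0 i))].
pose H x := inf (S x).
have Hle x y : H x <= H y + c * nrm (fun i => x i - y i).
  rewrite -lerBlDr; apply: lb_le_inf => // _ [a Aa <-].
  have : H x <= G a + c * nrm (fun i => x i - a i).
    by apply: ge_inf; [exact: (hS x).2|exists a].
  have := ler_wpM2l c0 (nrm_triangle y x a); rewrite mulrDr; lra.
exists H => [x y _ _|x Ax].
  rewrite ler_norml; have := Hle x y; have := Hle y x.
  rewrite (nrm_distC y x) => h1 h2; apply/andP; split; lra.
apply/eqP; rewrite eq_le; apply/andP; split.
  have : H x <= G x + c * nrm (fun i => x i - x i).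
    by apply: ge_inf; [exact: (hS x).2|exists x].
  by rewrite (_ : nrm _ = 0) ?mulr0 ?addr0 // /nrm big1 ?sqrtr0 // => i _;
    rewrite subrr expr0n.
apply: lb_le_inf => // _ [a Aa <-].
have := lG _ _ Ax Aa => /(le_trans (ler_norm _)); lra.
Qed.

End Extension.

Section Transfer.
Context {R : realType}.

(** For such exponents the tail bound to be proved exceeds every probability. *)
Lemma half_le_expR (x : R) : x <= ln 2 -> 1 <= 2 * expR (- x).
Proof.
move=> h; rewrite expRN -(@ler_pM2r _ (expR x)) ?expR_gt0 //.
rewrite -mulrA mulVf ?gt_eqF ?expR_gt0 // mulr1 mul1r.
by rewrite -[leRHS](@lnK R) ?posrE // ler_expR.
Qed.

Lemma expR_quarter_ge (x : R) : 4^-1 <= 2 * expR (- x) -> x <= 3 * ln 2.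
Proof.
move=> h; rewrite -ler_expR expRM_natl lnK ?posrE //.
move: h; rewrite expRN -(@ler_pM2r _ (expR x)) ?expR_gt0 //.
rewrite -mulrA mulVf ?gt_eqF ?expR_gt0 //; lra.
Qed.

Context {d : measure_display} {T : measurableType d} {I : finType}.
Context (P : probability T R).

(* Outside [A] nothing is known about [G] except its oscillation [D]; since
   tails beyond [D] vanish, a probability 2 exp (- theta D^2) is harmless. *)
Lemma concentration_transfer (Y : T -> I -> R) rho (G : (I -> R) -> R)
    (A : set (I -> R)) (B : set T) c theta D m t :
  (forall i, measurable_fun setT (fun w => Y w i)) ->
  measurable_fun setT (fun w => G (Y w)) ->
  measurable B -> (forall w, ~ B w -> A (Y w)) -> A !=set0 ->
  0 < rho -> 0 < c -> 0 < theta ->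
  concentrated P Y rho -> lip c A G ->
  (P B <= (2 * expR (- (theta * D ^+ 2)))%:E)%E ->
  (forall x y, `|G x - G y| <= D) ->
  is_median P (fun w => G (Y w)) m -> 0 < t ->
  (P [set w | t <= `|G (Y w) - m|]%R <=
    (2 * expR (- (Num.min (12 * (c * rho) ^+ 2)^-1 (theta / 3) * t ^+ 2)))%:E)%E.
Proof.
move=> mY mG mB AB A0 rho0 c0 th0 hc lG PA osc hm t0.
set k := Num.min _ _; pose r := c * rho.
have r0 : 0 < r by rewrite mulr_gt0.
have r20 : 0 < r ^+ 2 by rewrite exprn_gt0.
have k1 : k * (12 * r ^+ 2) <= 1.
  by rewrite -ler_pdivlMr ?mulr_gt0 // div1r ge_min lexx.
have k2 : k <= theta / 3 by rewrite ge_min lexx orbT.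
have k0 : 0 < k by rewrite lt_min invr_gt0 ?mulr_gt0 ?invr_gt0.
have t20 : 0 < t ^+ 2 by rewrite exprn_gt0.
have mE u : measurable [set w | u <= `|G (Y w) - m|].
  by apply: measurable_set_ge; exact: measurable_dist.
have smallkt : k * t ^+ 2 <= ln 2 ->
    (P [set w | t <= `|G (Y w) - m|]%R <= (2 * expR (- (k * t ^+ 2)))%:E)%E.
  move=> h; apply: (le_trans (probability_le1 _ _)) => //.
  by rewrite lee_fin half_le_expR.
have D0 : 0 <= D.
  by have [a _] := A0; apply: le_trans (osc a a); exact: normr_ge0.
(* The median lies between two values of G, so no deviation exceeds D. *)
have [tD|Dt] := leP t D; last first.
  rewrite (_ : [set w | _] = set0) ?measure0 ?lee_fin ?mulr_ge0 ?expR_ge0 //.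
  apply/seteqP; split => // w /= h.
  have [w1 h1] := median_lb_nonempty hm; have [w2 h2] := median_ub_nonempty hm.
  have := osc (Y w) (Y w1); have := osc (Y w) (Y w2).
  rewrite !ler_norml => /andP[? ?] /andP[? ?].
  move: h; rewrite leNgt => /negP; apply; rewrite ltr_norml; apply/andP; split; lra.
have t2D : t ^+ 2 <= D ^+ 2 by rewrite ler_sqr ?nnegrE // (ltW t0).
have ktD : 3 * (k * t ^+ 2) <= theta * D ^+ 2.
  by rewrite mulrA; apply: ler_pM => //; rewrite ?mulr_ge0 ?(ltW k0) ?(ltW t20) //; lra.
(* If the bound for P(B) exceeds 1/4, then theta D^2 <= 3 ln 2, and [theta / 3] in [k] makes the
   claim trivial. *)
have [dl|dl] := ltP 4^-1 (2 * expR (- (theta * D ^+ 2))).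
  by apply: smallkt; have := expR_quarter_ge (ltW dl); lra.
have [H lH HG] := lipschitz_extension (ltW c0) A0 lG.
have mH := lip_measurable mY lH.
have [m' hm'] := is_median_exists P mH.
have tail u : 0 < u ->
   (P [set w | u <= `|H (Y w) - m'|]%R <= (2 * expR (- (u ^+ 2 / r ^+ 2)))%:E)%E.
  by move=> u0; exact: hc c0 lH _ hm' _ u0.
have union (E : set T) u : measurable E -> 0 < u ->
    E `<=` [set w | u <= `|H (Y w) - m'|]%R `|` B ->
    (P E <= (2 * expR (- (u ^+ 2 / r ^+ 2)) + 2 * expR (- (theta * D ^+ 2)))%:E)%E.
  move=> mE' u0 sub; have mH' : measurable [set w | u <= `|H (Y w) - m'|]%R.
    by apply: measurable_set_ge; exact: measurable_dist.
  apply: (subset_probability_le mE' (measurableU _ _ mH' mB) sub).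
  apply: (le_trans (measureU2 _ mH' mB)).
  by rewrite EFinD; apply: leeD => //; exact: tail.
have ln20 : 0 < ln 2 :> R by rewrite ln_gt0 // ltr1n.
(* The event that G lies on the side of [m] away from [m'] has probability at least 1/2. Outside B
   it forces H to deviate from [m'] by |m - m'|, and B takes at most 1/4, so the tail of H at |m -
   m'| is at least 1/4. *)
have mm' : (m - m') ^+ 2 <= 3 * ln 2 * r ^+ 2.
  have [->|ne] := eqVneq m m'.
    rewrite subrr expr0n /=. nra.
  have u0 : 0 < `|m - m'| by rewrite normr_gt0 subr_eq0.
  suff : ((2^-1)%:E <= (2 * expR (- (`|m - m'| ^+ 2 / r ^+ 2))
      + 2 * expR (- (theta * D ^+ 2)))%:E)%E.
    rewrite lee_fin real_normK ?num_real // => h.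
    rewrite -ler_pdivrMr //; apply: expR_quarter_ge; lra.
  have [lt|ge] := ltP m m'.
    apply: (le_trans hm.1); apply: union => //; first exact: measurable_set_le.
    move=> w /= h; have [|nb] := pselect (B w); [by right|have a := AB w nb].
    left; rewrite /= HG // !(distrC _ m') !ger0_norm ?subr_ge0 //; lra.
  apply: (le_trans hm.2); apply: union => //; first exact: measurable_set_ge.
  move=> w /= h; have [|nb] := pselect (B w); [by right|have a := AB w nb].
  left; rewrite /= HG // !ger0_norm ?subr_ge0 //; lra.
(* Origin of the 12 in [k]: below this threshold k t^2 <= ln 2, above it |m - m'| <= t / 2, because
   12 = 4 * 3. *)
have [small|big] := ltP (t ^+ 2) (12 * ln 2 * r ^+ 2).
  apply: smallkt; apply: (@le_trans _ _ (k * (12 * ln 2 * r ^+ 2))).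
    by rewrite ler_pM2l // ltW.
  rewrite (_ : _ * _ = k * (12 * r ^+ 2) * ln 2); last by ring.
  by rewrite ler_piMl // ltW.
have mt : `|m - m'| <= t / 2.
  rewrite -ler_sqr ?nnegrE ?divr_ge0 ?(ltW t0) // real_normK ?num_real //.
  have -> : (t / 2) ^+ 2 = t ^+ 2 / 4 by field.
  lra.
have t2 : 0 < t / 2 by rewrite divr_gt0.
set e := expR (- (k * t ^+ 2)).
have e0 : 0 < e by rewrite expR_gt0.
have ee : e ^+ 2 = expR (- (2 * (k * t ^+ 2))).
  by rewrite /e -expRM_natl; congr expR; ring.
have e1 : expR (- ((t / 2) ^+ 2 / r ^+ 2)) <= e ^+ 2.
  rewrite ee ler_expR lerN2 ler_pdivlMr // (_ : (t / 2) ^+ 2 = t ^+ 2 / 4); last by field.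
  have := ler_wpM2r (ltW t20) k1; nra.
have e2 : expR (- (theta * D ^+ 2)) <= e ^+ 2.
  rewrite ee ler_expR lerN2.
  have : 0 < k * t ^+ 2 by rewrite mulr_gt0.
  lra.
(* Both tails are at most 2 e^2, and 4 e^2 <= 2 e when e <= 1/2; for larger e the claim is
   trivial. *)
have [eh|eh] := leP e 2^-1; last first.
  apply: (le_trans (probability_le1 _ (mE t))); rewrite lee_fin; lra.
have := union [set w | t <= `|G (Y w) - m|] _ (mE t) t2.
move=> /(_ _)/le_trans; apply.
  move=> w /= h; have [|nb] := pselect (B w); [by right|have a := AB w nb].
  left; rewrite /= HG //.
  have := ler_distD m' (G (Y w)) m; rewrite (distrC m' m); lra.
rewrite lee_fin; nra.
Qed.

End Transfer.

(** * Operator norms of concentrated random matrices *)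

Section OperatorNorm.
Context {R : realType} {d : measure_display} {T : measurableType d} {I : finType}.
Context (P : probability T R).

Lemma centered_bilin p q (M : T -> 'M[R]_(p, q)) v u :
  (forall i j, centered P (fun w => M w i j)) -> centered P (fun w => bilin (M w) v u).
Proof.
move=> cM.
pose f (ij : 'I_p * 'I_q) w : \bar R := ((v ij.1 * u ij.2)%:E * (M w ij.1 ij.2)%:E)%E.
have fi ij : P.-integrable setT (f ij) by apply: integrableZl => //; case: (cM ij.1 ij.2).
have fE w : (bilin (M w) v u)%:E = (\sum_(ij : 'I_p * 'I_q) f ij w)%E.
  rewrite /bilin pair_bigA sumEFin; congr EFin.
  by apply: eq_bigr => ij _ /=; ring.
split.
  rewrite (_ : EFin \o _ = fun w => \sum_(ij : 'I_p * 'I_q) f ij w)%E.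
    exact: integrable_sum.
  by apply/funext => w /=; rewrite fE.
under eq_integral do rewrite fE.
rewrite integral_sum // big1 // => ij _.
have [ci c0] := cM ij.1 ij.2.
by rewrite /f integralZl // c0 mule0.
Qed.

Lemma expR_ge_2 : 2 <= expR 1 :> R.
Proof. by have := @expR_ge1Dx R 1; lra. Qed.

(* [K^2 / (16 rho^2)] has to beat the logarithm [36 b N] of the number of grid
   pairs, with [N (L + 1)] to spare. *)
Definition opnorm_const (L : nat) (rho b : R) : R :=
  rho * (8 * expR 1 + 4 * (36 * b + 1 + L%:R)).

Lemma opnorm_const_gt0 L rho b : 0 < rho -> 0 < b -> 0 < opnorm_const L rho b :> R.
Proof.
move=> rho0 b0; rewrite mulr_gt0 // addr_gt0 ?mulr_gt0 ?expR_gt0 //.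
by have := ler0n R L; lra.
Qed.

Lemma opnorm_tail (Y : T -> I -> R) rho b L N p q
    (M : T -> 'M[R]_(p, q)) (h : 'I_p * 'I_q -> I) :
  (forall i, measurable_fun setT (fun w => Y w i)) -> 0 < rho ->
  concentrated P Y rho -> injective h ->
  (forall w i j, M w i j = Y w (h (i, j))) ->
  (forall i j, centered P (fun w => M w i j)) ->
  (0 < p)%N -> (0 < q)%N -> (0 < N)%N -> p%:R <= b * N%:R -> q%:R <= b * N%:R ->
  exists B : set T, [/\ measurable B,
    (P B <= (2 / L.+1%:R * expR (- N%:R))%:E)%E &
    forall w, ~ B w -> opbound (M w) (opnorm_const L rho b * Num.sqrt N%:R)].
Proof.
move=> mY rho0 hc hi hM cM p0 q0 N0 pb qb.
set K := opnorm_const L rho b.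
have N1 : 1 <= N%:R :> R by rewrite ler1n.
have b0 : 0 < b.
  rewrite -(pmulr_lgt0 _ (lt_le_trans ltr01 N1)); apply: lt_le_trans pb.
  by rewrite ltr0n.
pose mx (x : I -> R) : 'M[R]_(p, q) := \matrix_(i, j) x (h (i, j)).
have mxY w : mx (Y w) = M w by apply/matrixP => i j; rewrite mxE hM.
(* Half of the desired operator norm, as [opbound_grid] loses a factor 2. *)
pose s := K * Num.sqrt N%:R / 2.
pose ev (kl : grid p * grid q) : set T :=
  [set w | [&& kl.1 \in @unit_grid R p, kl.2 \in @unit_grid R q &
               s <= bilin (M w) (gridpt kl.1) (gridpt kl.2)]].
have lF kl : kl.1 \in @unit_grid R p -> kl.2 \in @unit_grid R q ->
    lip 1 setT (fun x => bilin (mx x) (gridpt kl.1) (gridpt kl.2)).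
  rewrite !inE => k1 l1 x y _ _; rewrite mul1r.
  have aux A : bilin A (gridpt kl.1) (gridpt kl.2) <= hsnorm A :> R.
    apply: (le_trans (opbound_hsnorm A _ _)).
    by rewrite ler_piMr ?hsnorm_ge0 // mulr_ile1 ?nrm_ge0.
  have le_nrm : hsnorm (mx x - mx y) <= nrm (fun i => x i - y i).
    rewrite hsnormE; apply: le_trans (nrm_inj (fun i => x i - y i) hi).
    by rewrite le_eqVlt; apply/orP; left; apply/eqP/eq_nrm => -[i j]; rewrite !mxE.
  rewrite ler_norml lerNl -bilin_mxB -bilinN opprB; apply/andP.
  by split; apply: le_trans (aux _) _ => //; rewrite hsnorm_distC.
have evE kl : ev kl = if (kl.1 \in @unit_grid R p) && (kl.2 \in @unit_grid R q)
    then [set w | s <= bilin (M w) (gridpt kl.1) (gridpt kl.2)] else set0.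
  apply/seteqP; split => w; rewrite /ev /=; case: (_ \in _) => //=; case: (_ \in _) => //=.
have mev kl : measurable (ev kl).
  rewrite evE; case: ifP => // /andP[k1 l1]; apply: measurable_set_ge.
  have := lip_measurable mY (lF _ k1 l1).
  by congr measurable_fun; apply/funext => w; rewrite mxY.
pose kap : R := 36 * b + 1 + L%:R.
have kap1 : 1 <= kap by rewrite /kap; have := ler0n R L; lra.
have sN1 : 1 <= Num.sqrt N%:R :> R by have := ler_wsqrtr N1; rewrite sqrtr1.
(* The summand 8 e in [opnorm_const] puts [s] above the threshold of [centered_upper_tail]. *)
have hs : 4 * expR 1 * rho <= s.
  have e1 := expR_ge_2.
  have KE : 8 * expR 1 * rho <= K.
    by rewrite /K /opnorm_const mulrC ler_pM2l // lerDl mulr_ge0 // -/kap; lra.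
  have : K <= K * Num.sqrt N%:R.
    rewrite ler_peMr // (le_trans _ KE) // !mulr_ge0 ?expR_ge0 ?(ltW rho0) //.
  by rewrite /s; lra.
have ptail kl : kl.1 \in @unit_grid R p -> kl.2 \in @unit_grid R q ->
    (P (ev kl) <= (2 * expR (- (s ^+ 2 / (4 * rho ^+ 2))))%:E)%E.
  move=> k1 l1; rewrite evE k1 l1 /=.
  have cF : centered P (fun w => bilin (mx (Y w)) (gridpt kl.1) (gridpt kl.2)).
    have := centered_bilin (gridpt kl.1) (gridpt kl.2) cM.
    by congr centered; apply/funext => w; rewrite mxY.
  have := centered_upper_tail mY rho0 hc (lF _ k1 l1) cF hs.
  by under eq_set do rewrite mxY.
pose ks := enum [set kl : grid p * grid q |
  (kl.1 \in @unit_grid R p) && (kl.2 \in @unit_grid R q)]%SET.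
pose e := 2 * expR (- (s ^+ 2 / (4 * rho ^+ 2))).
pose ev' kl := if kl \in ks then ev kl else set0.
exists (\big[setU/set0]_(kl <- ks) ev' kl); split.
- by apply: bigsetU_measurable => kl _; rewrite /ev'; case: ifP.
- apply: (le_trans (@probability_union_le _ _ _ P _ ks ev' e _ _)).
  + by move=> kl; rewrite /ev'; case: ifP.
  + move=> kl; rewrite /ev'; case: ifP.
      by rewrite mem_enum inE => /andP[k1 l1]; exact: ptail.
    by rewrite measure0 lee_fin mulr_ge0 ?expR_ge0.
  rewrite lee_fin -cardE.
  have -> : [set kl : grid p * grid q |
     (kl.1 \in @unit_grid R p) && (kl.2 \in @unit_grid R q)]%SET =
     finset.setX (@unit_grid R p) (@unit_grid R q).
    by apply/setP => kl; rewrite !inE.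
  rewrite cardsX natrM.
  have e2 := expR_ge_2.
  (* From 2 <= e and 18 (p + q) <= 36 b N. *)
  have cnt : (#|@unit_grid R p|)%:R * (#|@unit_grid R q|)%:R <= expR (36 * b * N%:R) :> R.
    apply: (@le_trans _ _ (expR 1 ^+ (18 * p) * expR 1 ^+ (18 * q))).
      apply: ler_pM; rewrite ?ler0n //.
        by apply: (le_trans (card_unit_grid p0)); rewrite lerXn2r ?nnegrE ?expR_ge0.
      by apply: (le_trans (card_unit_grid q0)); rewrite lerXn2r ?nnegrE ?expR_ge0.
    rewrite -exprD -expRM_natl mulr1 ler_expR natrD !natrM; lra.
  apply: (@le_trans _ _ (expR (36 * b * N%:R) * e)).
    by rewrite ler_wpM2r // mulr_ge0 ?expR_ge0.
  rewrite /e mulrCA -expRD -[leRHS]mulrA ler_pM2l //.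
  have sq : s ^+ 2 / (4 * rho ^+ 2) >= kap * N%:R.
    have -> : s ^+ 2 / (4 * rho ^+ 2) = (8 * expR 1 + 4 * kap) ^+ 2 / 16 * Num.sqrt N%:R ^+ 2.
      by rewrite /s /K /opnorm_const -/kap; field; rewrite gt_eqF.
    rewrite sqr_sqrtr ?ler0n // ler_wpM2r ?ler0n // ler_pdivlMr //; nra.
  (* The spare factor exp(- L N) pays for the division by L + 1, since L + 1 <= exp L. *)
  apply: (@le_trans _ _ (expR (- (L.+1%:R * N%:R)))).
    by rewrite ler_expR; move: sq; rewrite /kap -(natr1 L); lra.
  rewrite -(natr1 L) mulrDl mul1r opprD expRD ler_wpM2r ?expR_ge0 //.
  have L0 : 0 < L%:R + 1 :> R by rewrite natr1 ltr0n.
  rewrite expRN lef_pV2 ?posrE ?expR_gt0 //.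
  apply: (@le_trans _ _ (expR L%:R)).
    by have := @expR_ge1Dx R L%:R; lra.
  by rewrite ler_expR ler_peMr ?ler0n.
move=> w nB; apply: opbound_grid => // k l kg lg.
rewrite leNgt; apply/negP => hlt; apply: nB.
rewrite -bigcup_seq; exists (k, l).
  by rewrite /= mem_enum inE /= kg lg.
by rewrite /ev' mem_enum inE /= kg lg /ev /= kg lg /=; apply: ltW.
Qed.

End OperatorNorm.

(** * The network as a function of its parameters *)

(* Coordinates of the parameter vector (X, (W_l, B_l)_(l < L)). *)
Definition pindex (L n : nat) (dims : nat -> nat) : finType :=
  (('I_(dims 0) * 'I_n) + ({l : 'I_L & ('I_(dims l.+1) * 'I_(dims l))%type} +
     {l : 'I_L & ('I_(dims l.+1) * 'I_1)%type}))%type.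

Section ParameterVector.
Context {R : realType} {L n : nat} {dims : nat -> nat}.

Definition flat (X : 'M[R]_(dims 0, n))
    (W : forall l : 'I_L, 'M[R]_(dims l.+1, dims l))
    (B : forall l : 'I_L, 'cV[R]_(dims l.+1)) (i : pindex L n dims) : R :=
  match i with
  | inl ij => X ij.1 ij.2
  | inr (inl p) => W (tag p) (tagged p).1 (tagged p).2
  | inr (inr p) => B (tag p) (tagged p).1 (tagged p).2
  end.

Lemma nrm_flat X X' W W' B B' :
  nrm (fun i => flat X W B i - flat X' W' B' i) = param_dist X X' W W' B B'.
Proof.
congr Num.sqrt; rewrite big_sumType big_sumType big_split /=; congr (_ + (_ + _)).
- rewrite /hs2 pair_bigA; apply: eq_bigr => ij _; by rewrite !mxE.
- rewrite /hs2; under [RHS]eq_bigr do rewrite pair_bigA.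
  rewrite sig_big_dep; apply: eq_bigr => ij _; by rewrite !mxE.
- rewrite /hs2; under [RHS]eq_bigr do rewrite pair_bigA.
  rewrite sig_big_dep; apply: eq_bigr => ij _; by rewrite !mxE.
Qed.

Definition inX (ij : 'I_(dims 0) * 'I_n) : pindex L n dims := inl ij.
Definition inW (l : 'I_L) (ij : 'I_(dims l.+1) * 'I_(dims l)) : pindex L n dims :=
  inr (inl (Tagged (fun l : 'I_L => ('I_(dims l.+1) * 'I_(dims l))%type) ij)).
Definition inB (l : 'I_L) (ij : 'I_(dims l.+1) * 'I_1) : pindex L n dims :=
  inr (inr (Tagged (fun l : 'I_L => ('I_(dims l.+1) * 'I_1)%type) ij)).

Lemma inX_inj : injective inX.
Proof. by move=> ij kl []. Qed.

Lemma inW_inj l : injective (@inW l).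
Proof. by move=> ij kl [] /eqP; rewrite eq_Tagged => /eqP. Qed.

Lemma inB_inj l : injective (@inB l).
Proof. by move=> ij kl [] /eqP; rewrite eq_Tagged => /eqP. Qed.

Definition getX (x : pindex L n dims -> R) : 'M[R]_(dims 0, n) := \matrix_(i, j) x (inX (i, j)).

(* Junk value [0] for l >= L. *)
Definition getW (x : pindex L n dims -> R) (l : nat) : 'M[R]_(dims l.+1, dims l) :=
  if @idP (l < L)%N is ReflectT h then \matrix_(i, j) x (@inW (Ordinal h) (i, j)) else 0.
Definition getB (x : pindex L n dims -> R) (l : nat) : 'cV[R]_(dims l.+1) :=
  if @idP (l < L)%N is ReflectT h then \matrix_(i, j) x (@inB (Ordinal h) (i, j)) else 0.

Lemma flatX X W B : getX (flat X W B) = X.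
Proof. by apply/matrixP => i j; rewrite mxE. Qed.

Lemma flatW X (W : forall l, 'M[R]_(dims l.+1, dims l)) B l : (l < L)%N ->
  getW (flat X (fun l : 'I_L => W l) B) l = W l.
Proof. by move=> lL; rewrite /getW; destruct idP => //; apply/matrixP => a b; rewrite mxE. Qed.

Lemma flatB X W (B : forall l, 'cV[R]_(dims l.+1)) l : (l < L)%N ->
  getB (flat X W (fun l : 'I_L => B l)) l = B l.
Proof. by move=> lL; rewrite /getB; destruct idP => //; apply/matrixP => a b; rewrite mxE. Qed.

Lemma nrm_part p q (h : 'I_p * 'I_q -> pindex L n dims) (x y : pindex L n dims -> R) : injective h ->
  hsnorm (\matrix_(i, j) x (h (i, j)) - \matrix_(i, j) y (h (i, j))) <=
    nrm (fun i => x i - y i).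
Proof.
move=> hi; rewrite hsnormE; apply: le_trans (nrm_inj (fun i => x i - y i) hi).
by rewrite le_eqVlt; apply/orP; left; apply/eqP/eq_nrm => -[i j]; rewrite !mxE.
Qed.

Lemma hsnorm_getX x y : hsnorm (getX x - getX y) <= nrm (fun i => x i - y i).
Proof. exact: nrm_part inX_inj. Qed.

Lemma hsnorm_getW x y l : hsnorm (getW x l - getW y l) <= nrm (fun i => x i - y i).
Proof.
rewrite /getW; destruct idP as [h|]; first exact: (@nrm_part _ _ (@inW (Ordinal h)) x y (@inW_inj _)).
by rewrite subrr hsnorm0 nrm_ge0.
Qed.

Lemma hsnorm_getB x y l : hsnorm (getB x l - getB y l) <= nrm (fun i => x i - y i).
Proof.
rewrite /getB; destruct idP as [h|]; first exact: (@nrm_part _ _ (@inB (Ordinal h)) x y (@inB_inj _)).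
by rewrite subrr hsnorm0 nrm_ge0.
Qed.

(** Reconciles the given families, arbitrary from index L on, with [getW] and [getB], which are 0
    there. *)
Lemma Zlayer_ext sigma X (W W' : forall l, 'M[R]_(dims l.+1, dims l))
    (B B' : forall l, 'cV[R]_(dims l.+1)) l : (l <= L)%N ->
  (forall k, (k < L)%N -> W k = W' k) -> (forall k, (k < L)%N -> B k = B' k) ->
  Zlayer sigma X W B l = Zlayer sigma X W' B' l :> 'M[R]_(dims l, n).
Proof.
move=> + hW hB; elim: l => //= l ih lL.
by rewrite ih 1?ltnW // hW // hB.
Qed.

Section Concentrated.
Context {d : measure_display} {T : measurableType d}.
Context (P : probability T R) (rho : R).

Lemma flat_concentrated (X : T -> 'M[R]_(dims 0, n))
    (W : forall l, T -> 'M[R]_(dims l.+1, dims l))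
    (B : forall l, T -> 'cV[R]_(dims l.+1)) :
  (forall (F : 'M[R]_(dims 0, n) -> (forall l : 'I_L, 'M[R]_(dims l.+1, dims l)) ->
                   (forall l : 'I_L, 'cV[R]_(dims l.+1)) -> R),
         (forall x x' w w' b b', `|F x w b - F x' w' b'| <= param_dist x x' w w' b b') ->
         let Y := fun om => F (X om) (fun l => W l om) (fun l => B l om) in
         forall m, is_median P Y m ->
         forall t, 0 < t ->
         (P [set om | (t <= `|Y om - m|)%R] <= (2 * expR (- (t ^+ 2 / rho ^+ 2)))%:E)%E) ->
  concentrated P (fun w => flat (X w) (fun l => W l w) (fun l => B l w)) rho.
Proof.
move=> hc F c c0 lF m hm t t0.
have c'0 : 0 < c^-1 by rewrite invr_gt0.
have := hc (fun x w b => c^-1 * F (flat x w b)).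
move=> /(_ _ (c^-1 * m) _ (c^-1 * t)) h.
have set1 (G : R) : (c^-1 * t <= `|c^-1 * G - c^-1 * m|) = (t <= `|G - m|).
  by rewrite -mulrBr normrM (gtr0_norm c'0) ler_pM2l.
have -> : t ^+ 2 / (c * rho) ^+ 2 = (c^-1 * t) ^+ 2 / rho ^+ 2.
  by rewrite !exprMn invfM exprVn; ring.
under eq_set => w do rewrite -set1.
apply: h; last by rewrite mulr_gt0.
- move=> x x' w w' b b'; rewrite -mulrBr normrM (gtr0_norm c'0) ler_pdivrMl //.
  by rewrite -nrm_flat; exact: lF.
- case: hm => h1 h2; split.
    by under eq_set do rewrite ler_pM2l //.
  by under eq_set do rewrite ler_pM2l //.
Qed.

End Concentrated.

End ParameterVector.

(** * Size and Lipschitz constants of the layers *)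

Section Network.
Context {R : realType}.

(** There are n_l n entries, each at most kappa / sqrt n_l. Layer 0 is excluded because no
    activation bounds it. *)
Lemma Zlayer_bounded (L n : nat) (dims : nat -> nat) kappa (sigma : nat -> R -> R)
    (X : 'M[R]_(dims 0, n)) W B l : 0 <= kappa ->
  (forall l, (l < L)%N -> forall x, `|sigma l x| <= kappa) ->
  (0 < dims l)%N -> (0 < l <= L)%N ->
  hsnorm (Zlayer sigma X W B l) <= kappa * Num.sqrt n%:R.
Proof.
case: l => // l; move=> k0 hs d0 /= lL; rewrite hsnormZ ger0_norm ?invr_ge0 ?sqrtr_ge0 //.
have s0 : 0 < Num.sqrt (dims l.+1)%:R :> R by rewrite sqrtr_gt0 ltr0n.
rewrite ler_pdivrMl //.
apply: le_trans (hsnorm_bounded k0 _) _ => [i j|]; first by rewrite mxE hs.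
by rewrite natrM sqrtrM ?ler0n // mulrCA.
Qed.

(* Solution of the recursion z_(l+1) = lam (1 + K z_l) for the Lipschitz constants
   of the layers, in units of [lipeps]. *)
Fixpoint lipseq (lam K : R) (l : nat) : R :=
  if l is l'.+1 then lam * (1 + K * lipseq lam K l') else 0.

Lemma lipseq_ge0 lam K l : 0 <= lam -> 0 <= K -> 0 <= lipseq lam K l.
Proof. by move=> a b; elim: l => //= l ih; rewrite mulr_ge0 // addr_ge0 // mulr_ge0. Qed.

(* [K] bounds the operator norms of the W_l / sqrt n_(l+1) and of X / sqrt n_1, and
   [h] is a lower bound of n_0; what X, W_l and B_l each contribute to a layer
   is small when alpha -> 0 and h -> oo. *)
Definition lipeps (K kappa alpha h : R) : R :=
  2 * K / Num.sqrt h + (kappa + 1) * Num.sqrt alpha.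

Lemma lipeps_gt0 K kappa alpha h : 0 < K -> 0 < kappa -> 0 < alpha -> 0 < h ->
  0 < lipeps K kappa alpha h :> R.
Proof.
move=> K0 k0 a0 h0; apply: addr_gt0; first by rewrite divr_gt0 ?sqrtr_gt0 // mulr_gt0.
by rewrite mulr_gt0 ?sqrtr_gt0 // addr_gt0.
Qed.

(** Induction on W Z - W' Z' = (W - W') Z + W' (Z - Z'), which explains why [X] is bounded at one
    point and [W'] at the other. The induction starts at layer 1: for Z = X / sqrt n_0 the first
    term needs the operator norm of X, later |Z| <= kappa sqrt n suffices. The bias contributes sqrt
    n |B - B'|, hence sqrt alpha D after normalization. *)
Lemma Zlayer_lip (L n : nat) (dims : nat -> nat) lam kappa alpha h K D
    (sigma : nat -> R -> R) (X X' : 'M[R]_(dims 0, n))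
    (W W' : forall l, 'M[R]_(dims l.+1, dims l))
    (B B' : forall l, 'cV[R]_(dims l.+1)) l :
  0 <= lam -> 0 <= kappa -> 0 <= K -> 0 <= D -> 0 <= alpha -> 0 < h ->
  (forall l, (l <= L)%N -> (0 < dims l)%N) ->
  (forall l, (l < L)%N -> forall x y, `|sigma l x - sigma l y| <= lam * `|x - y|) ->
  (forall l, (l < L)%N -> forall x, `|sigma l x| <= kappa) ->
  (forall l, (1 <= l <= L)%N -> n%:R <= alpha * (dims l)%:R) ->
  h <= (dims 0)%:R ->
  hsnorm (X - X') <= D ->
  (forall l, (l < L)%N -> hsnorm (W l - W' l) <= D) ->
  (forall l, (l < L)%N -> hsnorm (B l - B' l) <= D) ->
  opbound X (K * Num.sqrt (dims 1)%:R) ->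
  (forall l, (l < L)%N -> opbound (W' l) (K * Num.sqrt (dims l.+1)%:R)) ->
  (0 < l <= L)%N ->
  hsnorm (Zlayer sigma X W B l - Zlayer sigma X' W' B' l) <=
    lipeps K kappa alpha h * lipseq lam K l * D.
Proof.
move=> lam0 k0 K0 D0 al0 h0 dpos slip sbd na hd hX hW hB oX oW.
have sal : 0 <= Num.sqrt alpha by exact: sqrtr_ge0.
have eps0 : 0 <= lipeps K kappa alpha h.
  by rewrite /lipeps addr_ge0 // ?mulr_ge0 ?divr_ge0 ?sqrtr_ge0 ?mulr_ge0 ?addr_ge0.
have step k z : (k < L)%N ->
    hsnorm ((W k - W' k) *m Zlayer sigma X W B k) / Num.sqrt (dims k.+1)%:R
    + hsnorm (W' k *m (Zlayer sigma X W B k - Zlayer sigma X' W' B' k))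
       / Num.sqrt (dims k.+1)%:R
    + Num.sqrt alpha * D <= z ->
    hsnorm (Zlayer sigma X W B k.+1 - Zlayer sigma X' W' B' k.+1) <= lam * z.
  move=> kL hz.
  have s0 : 0 < Num.sqrt (dims k.+1)%:R :> R by rewrite sqrtr_gt0 ltr0n dpos.
  have sn : Num.sqrt n%:R <= Num.sqrt alpha * Num.sqrt (dims k.+1)%:R.
    by rewrite -sqrtrM // ler_wsqrtr // na.
  apply: le_trans (ler_wpM2l lam0 hz).
  rewrite /= -scalerBr hsnormZ ger0_norm ?invr_ge0 ?sqrtr_ge0 //.
  set Z := Zlayer _ _ _ _ _; set Z' := Zlayer _ _ _ _ _.
  set U := W k *m Z + _; set U' := W' k *m Z' + _.
  apply: (@le_trans _ _ ((Num.sqrt (dims k.+1)%:R)^-1 * (lam * hsnorm (U - U')))).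
    rewrite ler_wpM2l ?invr_ge0 ?sqrtr_ge0 //; apply: ler_hsnorm => // i j.
    by rewrite !mxE; apply: slip.
  rewrite mulrCA ler_wpM2l // ler_pdivrMl //.
  have -> : U - U' = (W k - W' k) *m Z + W' k *m (Z - Z') + (B k - B' k) *m const_mx 1.
    by rewrite /U /U' !mulmxBl mulmxBr subrKA opprD addrACA.
  apply: (le_trans (hsnormD _ _)); rewrite mulrDr lerD //.
    apply: (le_trans (hsnormD _ _)).
    by rewrite mulrDr !(mulrC _ (_ / _)) !divfK ?gt_eqF.
  rewrite hsnorm_const1 mulrA (mulrC (Num.sqrt _) (Num.sqrt alpha)).
  by apply: ler_pM => //; rewrite ?sqrtr_ge0 ?hsnorm_ge0 // hB.
case: l => // l /andP[_]; elim: l => [|l ih] lL.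
  have d1 : 0 < Num.sqrt (dims 1)%:R :> R by rewrite sqrtr_gt0 ltr0n dpos.
  have d0 : 0 < Num.sqrt (dims 0)%:R :> R by rewrite sqrtr_gt0 ltr0n dpos.
  have sh0 : 0 < Num.sqrt h by rewrite sqrtr_gt0.
  have shd : (Num.sqrt (dims 0)%:R)^-1 <= (Num.sqrt h)^-1.
    by rewrite lef_pV2 ?posrE // ler_wsqrtr.
  rewrite [lipseq _ _ _]/= mulr0 addr0 mulr1 mulrAC mulrC; apply: step => //=.
  rewrite -scalemxAr -scalerBr -scalemxAr !hsnormZ ger0_norm ?invr_ge0 ?sqrtr_ge0 //.
  have t1 : hsnorm ((W 0 - W' 0) *m X) <= K * Num.sqrt (dims 1)%:R * D.
    apply: le_trans (opbound_mulr _ _ oX) _; first by rewrite mulr_ge0 ?sqrtr_ge0.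
    by rewrite ler_wpM2l ?mulr_ge0 ?sqrtr_ge0 // hW.
  have t2 : hsnorm (W' 0 *m (X - X')) <= K * Num.sqrt (dims 1)%:R * D.
    apply: le_trans (opbound_mull _ _ (oW 0 lL)) _; first by rewrite mulr_ge0 ?sqrtr_ge0.
    by rewrite ler_wpM2l ?mulr_ge0 ?sqrtr_ge0.
  have bd x : 0 <= x -> x <= K * Num.sqrt (dims 1)%:R * D ->
      (Num.sqrt (dims 0)%:R)^-1 * x / Num.sqrt (dims 1)%:R <= K / Num.sqrt h * D.
    move=> x0 hx; rewrite ler_pdivrMr //.
    apply: (@le_trans _ _ ((Num.sqrt h)^-1 * (K * Num.sqrt (dims 1)%:R * D))).
      by apply: ler_pM => //; rewrite invr_ge0 sqrtr_ge0.
    by rewrite le_eqVlt; apply/orP; left; apply/eqP; ring.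
  have b1 := bd _ (hsnorm_ge0 _) t1; have b2 := bd _ (hsnorm_ge0 _) t2.
  apply: (@le_trans _ _ (2 * K / Num.sqrt h * D + Num.sqrt alpha * D)); first lra.
  have : 0 <= kappa * Num.sqrt alpha * D by rewrite !mulr_ge0.
  rewrite /lipeps; lra.
have {}ih := ih (ltnW lL).
have s0 : 0 < Num.sqrt (dims l.+2)%:R :> R by rewrite sqrtr_gt0 ltr0n dpos.
set a := lipseq lam K l.+1 in ih *.
rewrite (_ : lipseq lam K l.+2 = lam * (1 + K * a)) //.
rewrite mulrCA -mulrA; apply: step => //.
have sn : Num.sqrt n%:R <= Num.sqrt alpha * Num.sqrt (dims l.+2)%:R.
  by rewrite -sqrtrM // ler_wsqrtr // na.
have t1 : hsnorm ((W l.+1 - W' l.+1) *m Zlayer sigma X W B l.+1)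
    / Num.sqrt (dims l.+2)%:R <= kappa * Num.sqrt alpha * D.
  rewrite ler_pdivrMr //; apply: (le_trans (hsnormM _ _)).
  apply: (@le_trans _ _ (D * (kappa * Num.sqrt n%:R))).
    apply: ler_pM; rewrite ?hsnorm_ge0 ?hW //.
    by apply: Zlayer_bounded sbd _ _ => //; [exact: dpos (ltnW lL)|exact: ltnW].
  rewrite mulrCA -!mulrA ler_wpM2l // [leRHS]mulrCA ler_wpM2l //.
have t2 : hsnorm (W' l.+1 *m (Zlayer sigma X W B l.+1 - Zlayer sigma X' W' B' l.+1))
    / Num.sqrt (dims l.+2)%:R <= K * (lipeps K kappa alpha h * a * D).
  rewrite ler_pdivrMr //.
  apply: le_trans (opbound_mull _ _ (oW l.+1 lL)) _; first by rewrite mulr_ge0 ?sqrtr_ge0.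
  by rewrite mulrAC ler_wpM2r ?sqrtr_ge0 // ler_wpM2l.
have t3 : (kappa + 1) * Num.sqrt alpha * D <= lipeps K kappa alpha h * D.
  by rewrite /lipeps [leRHS]mulrDl lerDr mulr_ge0 // divr_ge0 ?sqrtr_ge0 // mulr_ge0.
rewrite -/a; lra.
Qed.

End Network.

(** * The explicit rate and its limit *)

Section Main.
Context {R : realType}.

(** Activations are only assumed Lipschitz; they are treated as functions of one coordinate indexed
    by ['I_1]. *)
Lemma lip_comp_measurable {d} {T : measurableType d} (f : T -> R) (g : R -> R) c :
  0 <= c -> measurable_fun setT f -> (forall x y, `|g x - g y| <= c * `|x - y|) ->
  measurable_fun setT (fun w => g (f w)).
Proof.
move=> c0 mf lg.
apply: (@lip_measurable _ _ _ 'I_1 (fun w _ => f w) (fun x => g (x ord0)) c) => //.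
move=> x y _ _; apply: (le_trans (lg _ _)); rewrite ler_wpM2l //.
exact: (abs_le_nrm (fun i => x i - y i)).
Qed.

Lemma Zlayer_measurable {d} {T : measurableType d} (L n : nat) (dims : nat -> nat)
    lam (sigma : nat -> R -> R) (X : T -> 'M[R]_(dims 0, n))
    (W : forall l, T -> 'M[R]_(dims l.+1, dims l))
    (B : forall l, T -> 'cV[R]_(dims l.+1)) l i j : 0 <= lam ->
  (forall l, (l < L)%N -> forall x y, `|sigma l x - sigma l y| <= lam * `|x - y|) ->
  (forall i j, measurable_fun setT (fun w => X w i j)) ->
  (forall l, (l < L)%N -> forall i j, measurable_fun setT (fun w => W l w i j)) ->
  (forall l, (l < L)%N -> forall i j, measurable_fun setT (fun w => B l w i j)) ->
  (l <= L)%N ->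
  measurable_fun setT
    (fun w => Zlayer sigma (X w) (fun l => W l w) (fun l => B l w) l i j).
Proof.
move=> lam0 slip mX mW mB; elim: l i j => [|l ih] i j lL /=.
  under eq_fun do rewrite mxE.
  exact: measurable_funM (measurable_cst _) (mX i j).
under eq_fun do rewrite !mxE.
apply: measurable_funM; first exact: measurable_cst.
apply: (lip_comp_measurable lam0 _ (slip l lL)).
apply: measurable_funD.
  apply: measurable_sum => k; apply: measurable_funM; first exact: mW.
  exact: ih (ltnW lL).
apply: measurable_sum => k; apply: measurable_funM; first exact: mB.
by under eq_fun do rewrite mxE; exact: measurable_cst.
Qed.

(** The two arguments of the minimum stem from the good event and its complement. The summand 1
    keeps the Lipschitz constant positive when [lam] = 0; [b] is separate from [alpha] so that [K]
    does not move with it. *)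
Definition rate (L : nat) (rho lam kappa b alpha h : R) : R :=
  let K := opnorm_const L rho b in
  Num.min (12 * (lipeps K kappa alpha h * (lipseq lam K L + 1) * rho) ^+ 2)^-1
    ((4 * kappa ^+ 2 * alpha)^-1 / 3).

(** [h] is a positive lower bound of n_0: the choice 1 serves for arbitrary [eta], the choice [eta]
    for the limit. Absolute values of [lam] and [kappa] cover parameters of any sign. *)
Lemma rate_admissible (L : nat) (rho lam kappa beta b alpha eta h : R) :
  (0 < L)%N -> 0 < rho -> 1 <= b -> beta <= b -> 0 < alpha -> alpha <= b ->
  0 < h -> (forall k : nat, (0 < k)%N -> eta <= k%:R -> h <= k%:R) ->
  admissible_const L rho lam kappa alpha beta eta
    (rate L rho `|lam| (`|kappa| + 1) b alpha h).
Proof.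
move=> L0 rho0 b1 betab al0 alb h0 hh d T P n dims X W B sigma.
move=> [n0 dpos [mX [mW mB]] [hconc [cX cW] [slip sbd] [hal hbe] heta]] F lF Y m hm t t0.
set lam' := `|lam|; set kap := `|kappa| + 1.
have kap0 : 0 < kap by rewrite ltr_wpDl.
have {}slip l : (l < L)%N -> forall x y, `|sigma l x - sigma l y| <= lam' * `|x - y|.
  by move=> lL x y; apply: (le_trans (slip l lL x y)); rewrite ler_wpM2r // ler_norm.
have {}sbd l : (l < L)%N -> forall x, `|sigma l x| <= kap.
  move=> lL x; apply: (le_trans (sbd l lL x)); rewrite /kap.
  by have := ler_norm kappa; lra.
have {}hal l : (1 <= l <= L)%N -> n%:R <= alpha * (dims l)%:R.
  move=> lL; have := hal l lL; rewrite ler_pdivrMr // ltr0n dpos //.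
  by case/andP: lL.
have {}hbe l : (l < L)%N -> (dims l)%:R <= beta * (dims l.+1)%:R.
  by move=> lL; have := hbe l.+1 lL; rewrite ler_pdivrMr // ltr0n dpos.
pose Yp w := flat (X w) (fun l : 'I_L => W l w) (fun l : 'I_L => B l w).
have conc : concentrated P Yp rho by exact: flat_concentrated.
have mY i : measurable_fun setT (fun w => Yp w i).
  by case: i => [ij|[p|p]]; [exact: mX|exact: mW|exact: mB].
pose G (x : pindex L n dims -> R) :=
  F (Zlayer sigma (getX x) (getW x) (getB x) L).
have GY w : G (Yp w) = Y w.
  rewrite /G /Y flatX; congr F; apply: (@Zlayer_ext _ L) => // k kL.
    exact: (flatW (X w) (fun l => W l w) _ kL).
  exact: (flatB (X w) _ (fun l => B l w) kL).
have mG : measurable_fun setT (fun w => G (Yp w)).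
  (* G need not be Lipschitz in the parameters, so measurability comes from F, which is Lipschitz in
     the entries of Z_L. *)
  under eq_fun do rewrite GY.
  pose Yz w (ij : 'I_(dims L) * 'I_n) :=
    Zlayer sigma (X w) (fun l => W l w) (fun l => B l w) L ij.1 ij.2.
  have -> : Y = fun w => (fun x => F (\matrix_(i, j) x (i, j))) (Yz w).
    by apply/funext => w; rewrite /Y; congr F; apply/matrixP => i j; rewrite mxE.
  apply: (@lip_measurable _ _ _ _ Yz (fun x => F (\matrix_(i, j) x (i, j))) 1).
    by move=> ij; exact: (Zlayer_measurable _ _ (normr_ge0 lam) slip mX mW mB (leqnn L)).
  move=> x y _ _; apply: (le_trans (lF _ _)); rewrite mul1r hsnormE.
  by rewrite le_eqVlt; apply/orP; left; apply/eqP/eq_nrm => -[i j]; rewrite !mxE.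
set K := opnorm_const L rho b.
have b0 : 0 < b by exact: lt_le_trans b1.
have K0 : 0 < K by exact: opnorm_const_gt0.
pose A : set (pindex L n dims -> R) := [set x |
  opbound (getX x) (K * Num.sqrt (dims 1)%:R) /\
  forall l, (l < L)%N -> opbound (getW x l) (K * Num.sqrt (dims l.+1)%:R)].
(* [None] stands for X, so one finite type indexes all L + 1 matrices. *)
pose Q (o : option 'I_L) w := if o is Some l
  then opbound (W l w) (K * Num.sqrt (dims l.+1)%:R)
  else opbound (X w) (K * Num.sqrt (dims 1)%:R).
pose e : R := 2 / L.+1%:R * expR (- (n%:R / alpha)).
have He (N : nat) : n%:R <= alpha * N%:R -> 2 / L.+1%:R * expR (- N%:R) <= e.
  move=> hN; rewrite ler_wpM2l ?divr_ge0 // ler_expR lerN2 ler_pdivrMr // mulrC.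
  exact: hN.
have d1 : (0 < dims 1)%N by exact: dpos.
have d0 : (0 < dims 0)%N by exact: dpos.
have ble (x c : R) (N : nat) : c <= b -> x <= c * N%:R -> x <= b * N%:R.
  by move=> cb /le_trans; apply; rewrite ler_wpM2r ?ler0n.
have /choice[bad hbad] : forall o, exists B : set T,
    [/\ measurable B, (P B <= e%:E)%E & forall w, ~ B w -> Q o w].
  case=> [l|].
    have lL := ltn_ord l.
    have pb : (dims l.+1)%:R <= b * (dims l.+1)%:R by rewrite ler_peMl.
    have [B' [mB' PB' HB']] := opnorm_tail L mY rho0 conc
      (@inW_inj L n dims l) (fun w i j => erefl : W l w i j = _) (cW l lL)
      (dpos _ lL) (dpos _ (ltnW lL)) (dpos _ lL) pb (ble _ _ _ betab (hbe l lL)).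
    by exists B'; split => //; apply: (le_trans PB'); rewrite lee_fin He // hal.
  have [B' [mB' PB' HB']] := opnorm_tail L mY rho0 conc
    (@inX_inj L n dims) (fun w i j => erefl : X w i j = _) cX
    d0 n0 d1 (ble _ _ _ betab (hbe 0 L0)) (ble _ _ _ alb (hal 1 L0)).
  by exists B'; split => //; apply: (le_trans PB'); rewrite lee_fin He // hal.
pose N := \big[setU/set0]_(o : option 'I_L) bad o.
have mN : measurable N.
  by apply: bigsetU_measurable => o _; case: (hbad o).
have NA w : ~ N w -> A (Yp w).
  move=> nN; have good o : Q o w.
    have [_ _] := hbad o; apply => hb; apply: nN; rewrite /N -bigcup_seq.
    by exists o => //=; rewrite mem_index_enum.
  split; first by rewrite flatX; exact: (good None).
  move=> l lL; have -> : getW (Yp w) l = W l w by exact: (flatW (X w) (fun l => W l w) _ lL).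
  exact: (good (Some (Ordinal lL))).
(* Two outputs of norm at most kap sqrt n differ by at most D; [theta] is chosen so that theta D^2 =
   n / alpha. *)
pose D := 2 * kap * Num.sqrt n%:R.
pose theta := (4 * kap ^+ 2 * alpha)^-1.
have th0 : 0 < theta by rewrite invr_gt0 !mulr_gt0 // exprn_gt0.
have PN : (P N <= (2 * expR (- (theta * D ^+ 2)))%:E)%E.
  have -> : theta * D ^+ 2 = n%:R / alpha.
    rewrite /theta /D !exprMn sqr_sqrtr ?ler0n //; field.
    by rewrite !gt_eqF.
  have := @probability_union_le _ _ _ P _ (index_enum (option 'I_L)) bad e.
  rewrite -/N => /(_ _ _)/le_trans; apply.
  - by move=> o; case: (hbad o).
  - by move=> o; case: (hbad o).
  have -> : size (index_enum (option 'I_L)) = L.+1.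
    by rewrite -[index_enum _]enumT -cardT card_option card_ord.
  rewrite lee_fin /e mulrA mulrCA mulfV ?mulr1 // pnatr_eq0 //.
have osc x y : `|G x - G y| <= D.
  apply: (le_trans (lF _ _)); apply: (le_trans (hsnormD _ _)).
  rewrite -scaleN1r hsnormZ normrN1 mul1r /D.
  have zb (z : pindex L n dims -> R) := Zlayer_bounded (getX z) (getW z) (getB z) (ltW kap0) sbd
    (dpos _ (leqnn L)) (introT andP (conj L0 (leqnn L))).
  have := zb x; have := zb y; lra.
have eps0 : 0 < lipeps K kap alpha h by exact: lipeps_gt0.
have ls0 l : 0 <= lipseq lam' K l by exact: lipseq_ge0 (normr_ge0 lam) (ltW K0).
have lG : lip (lipeps K kap alpha h * (lipseq lam' K L + 1)) A G.
  move=> x y [Ax _] [_ Ay]; apply: (le_trans (lF _ _)).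
  apply: (@le_trans _ _ (lipeps K kap alpha h * lipseq lam' K L *
      nrm (fun i => x i - y i))); last first.
    by rewrite ler_wpM2r ?nrm_ge0 // ler_wpM2l ?(ltW eps0) //; lra.
  apply: (@Zlayer_lip R L n dims lam' kap alpha h K) => //; rewrite ?L0 ?leqnn //.
  - exact: normr_ge0.
  - exact: ltW.
  - exact: ltW.
  - exact: nrm_ge0.
  - exact: ltW.
  - exact: hh.
  - exact: hsnorm_getX.
  - by move=> l _; exact: hsnorm_getW.
  - by move=> l _; exact: hsnorm_getB.
have A0 : A !=set0.
  have s0 (k : nat) : 0 <= K * Num.sqrt k%:R by rewrite (mulr_ge0 (ltW K0)) ?sqrtr_ge0.
  exists (fun=> 0); split=> [|l _]; apply: (opbound0 (s0 _)) => i j; first by rewrite mxE.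
  by rewrite /getW; case: {-}_ / idP => *; rewrite mxE.
have c0 : 0 < lipeps K kap alpha h * (lipseq lam' K L + 1).
  by rewrite mulr_gt0 // ltr_wpDl.
have hmG : is_median P (fun w => G (Yp w)) m by under eq_fun do rewrite GY.
have := concentration_transfer mY mG mN NA A0 rho0 c0 th0 conc lG PN osc hmG t0.
by under eq_set do rewrite GY.
Qed.

Lemma rate_gt0 (L : nat) (rho lam kappa b alpha h : R) :
  0 < rho -> 0 < b -> 0 < alpha -> 0 < h -> 0 <= lam -> 0 < kappa ->
  0 < rate L rho lam kappa b alpha h.
Proof.
move=> rho0 b0 al0 h0 lam0 kap0.
have K0 : 0 < opnorm_const L rho b by exact: opnorm_const_gt0.
rewrite /rate lt_min; apply/andP; split; last first.
  by rewrite divr_gt0 // invr_gt0 !mulr_gt0 // exprn_gt0.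
rewrite invr_gt0 mulr_gt0 // exprn_gt0 // mulr_gt0 // mulr_gt0 ?lipeps_gt0 //.
by rewrite ltr_wpDl // lipseq_ge0 // ltW.
Qed.

Lemma rate_large (L : nat) (rho lam kappa b M : R) :
  0 < rho -> 0 < b -> 0 <= lam -> 0 < kappa -> exists delta H : R,
  [/\ 0 < delta, 0 < H & forall alpha h, 0 < alpha -> alpha < delta -> H <= h ->
    M <= rate L rho lam kappa b alpha h].
Proof.
move=> rho0 b0 lam0 kap0.
pose K := opnorm_const L rho b.
have K0 : 0 < K by exact: opnorm_const_gt0.
pose a := lipseq lam K L + 1.
have a0 : 0 < a by rewrite ltr_wpDl // lipseq_ge0 // ltW.
pose M' := `|M| + 1.
have M'1 : 1 <= M' by rewrite lerDr.
have M'0 : 0 < M' by exact: lt_le_trans M'1.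
have MM' : M <= M' by rewrite (le_trans (ler_norm M)) // lerDl.
(* Target for [lipeps]: it gives 12 (e a rho)^2 = 12 / (16 M'^2) <= 1 / M', as M' >= 1. *)
pose e := (4 * M' * (a * rho))^-1.
have e0 : 0 < e by rewrite invr_gt0 !mulr_gt0.
have ea : 12 * (e * a * rho) ^+ 2 <= M'^-1.
  have -> : e * a * rho = (4 * M')^-1.
    by rewrite /e; field; rewrite !gt_eqF.
  rewrite -[leRHS]div1r ler_pdivlMr //.
  have -> : 12 * (4 * M')^-1 ^+ 2 * M' = 12 / 16 / M' by field; rewrite gt_eqF.
  rewrite ler_pdivrMr //; lra.
(* [d1] and the lower bound on h each keep one summand of [lipeps] below e / 2; [d2] handles the
   second argument of the minimum in [rate]. *)
pose d1 := (e / 2 / (kappa + 1)) ^+ 2.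
pose d2 := (12 * kappa ^+ 2 * M')^-1.
have k1 : 0 < kappa + 1 by rewrite addr_gt0.
exists (Num.min d1 d2), ((4 * K / e) ^+ 2); split.
- by rewrite lt_min exprn_gt0 ?divr_gt0 // invr_gt0 !mulr_gt0 // exprn_gt0.
- by rewrite exprn_gt0 // divr_gt0 // mulr_gt0.
move=> alpha h al0; rewrite lt_min => /andP[hd1 hd2] hh.
have q0 : 0 < 4 * K / e by rewrite divr_gt0 // mulr_gt0.
have sh : 4 * K / e <= Num.sqrt h.
  by rewrite -(ger0_norm (ltW q0)) -sqrtr_sqr ler_wsqrtr.
have sh0 : 0 < Num.sqrt h by exact: lt_le_trans sh.
have h0 : 0 < h by rewrite -sqrtr_gt0.
have sa : Num.sqrt alpha <= e / 2 / (kappa + 1).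
  rewrite -[leRHS]ger0_norm ?divr_ge0 ?(ltW e0) ?(ltW k1) // -sqrtr_sqr.
  by rewrite ler_wsqrtr // ltW.
have eps : lipeps K kappa alpha h <= e.
  have : 2 * K / Num.sqrt h <= e / 2.
    rewrite ler_pdivrMr //; move: sh; rewrite ler_pdivrMr //; lra.
  have : (kappa + 1) * Num.sqrt alpha <= e / 2.
    by move: sa; rewrite ler_pdivlMr // mulrC.
  rewrite /lipeps; lra.
have eps0 : 0 < lipeps K kappa alpha h by exact: lipeps_gt0.
apply: (le_trans MM'); rewrite /rate -/K -/a le_min; apply/andP; split.
  rewrite -[leLHS]invrK lef_pV2 ?posrE ?invr_gt0 //; last first.
    by rewrite mulr_gt0 // exprn_gt0 // !mulr_gt0.
  apply: le_trans ea; rewrite ler_pM2l // ler_sqr ?nnegrE; last 2 first.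
  - by rewrite !mulr_ge0 // ltW.
  - by rewrite !mulr_ge0 // ltW.
  by rewrite !ler_pM2r.
rewrite ler_pdivlMr // -[leLHS]invrK lef_pV2 ?posrE ?invr_gt0 ?mulr_gt0 ?exprn_gt0 //.
apply: (@le_trans _ _ (4 * kappa ^+ 2 * d2)).
  by rewrite ler_pM2l ?mulr_gt0 ?exprn_gt0 // ltW.
by rewrite le_eqVlt; apply/orP; left; apply/eqP; rewrite /d2; field; rewrite !gt_eqF.
Qed.

End Main.

Theorem theorem3p1 (R : realType) (L : nat) (rho lam kappa beta : R) :
  (0 < L)%N -> 0 < rho ->
  (* existence of c > 0 depending only on the parameters *)
  (forall alpha eta : R, exists c : R, 0 < c /\
     admissible_const L rho lam kappa alpha beta eta c) /\
  (* c_opt -> +oo as alpha -> 0 and eta -> +oo (other parameters fixed):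
     for every M there are delta, H with an admissible c >= M whenever
     0 < alpha < delta and eta >= H *)
  (forall M : R, exists delta H : R, 0 < delta /\
     forall alpha eta : R, 0 < alpha -> alpha < delta -> H <= eta ->
     exists c : R, M <= c /\ admissible_const L rho lam kappa alpha beta eta c).
Proof.
move=> L0 rho0; set lam' := `|lam|; set kap := `|kappa| + 1.
have lam0 : 0 <= lam' by exact: normr_ge0.
have kap0 : 0 < kap by rewrite ltr_wpDl.
split=> [alpha eta|M].
  (* No model exists here, since 0 < n / n_1 <= alpha. *)
  have [al0|al0] := leP alpha 0.
    exists 1; split => // d T P n dims X W B sigma [n0 dpos _ [_ _ _ [hal _] _]].
    have := hal 1 L0; have : 0 < n%:R / (dims 1)%:R :> R.
      by rewrite divr_gt0 ?ltr0n ?dpos.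
    lra.
  pose b := `|beta| + alpha + 1.
  have hb := ler_norm beta; have hb0 := normr_ge0 beta.
  exists (rate L rho lam' kap b alpha 1); split.
    by apply: rate_gt0 => //; rewrite /b; lra.
  apply: rate_admissible => //; rewrite /b; try lra.
  by move=> k k0 _; rewrite ler1n.
pose b := `|beta| + 1.
have hb := ler_norm beta; have hb0 := normr_ge0 beta.
have b0 : 0 < b by rewrite /b; lra.
have [delta [H [d0 H0 hr]]] := rate_large L M rho0 b0 lam0 kap0.
(* The cap 1 ensures alpha <= b for a [b] chosen before alpha. *)
exists (Num.min delta 1), H; split; first by rewrite lt_min d0 /=.
move=> alpha eta al0; rewrite lt_min => /andP[ald al1] He.
exists (rate L rho lam' kap b alpha eta); split; first exact: hr.
by apply: rate_admissible => //; rewrite /b; lra.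
Qed.
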